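(* Let $k$ be an algebraically closed field, let $q\in k^\times$ be not a root of unity, let $A=\mathcal{O}_q(M_2(k))$ with quantum determinant $\Delta=ad-qbc$, and let $R=A/\langle\Delta\rangle$. Then the height $1$ prime ideals of $R$ are precisely the ideals $\langle\Delta,\,b-\lambda c\rangle/\langle\Delta\rangle$ for $\lambda\in k^\times$, together with the four ideals $\langle a,b\rangle/\langle\Delta\rangle$, $\langle b,d\rangle/\langle\Delta\rangle$, $\langle a,c\rangle/\langle\Delta\rangle$, $\langle c,d\rangle/\langle\Delta\rangle$. Each ideal $\langle\Delta,\,b-\lambda c\rangle/\langle\Delta\rangle$ with $\lambda\in k^\times$ is generated by a normal element of $R$, and none of the four remaining ideals is generated by a normal element of $R$. Thus $R$ has infinitely many height $1$ prime ideals, all but exactly four of which are generated by a normal element.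
   Context: $\mathcal{O}_q(M_2(k))$ is the $k$-algebra with generators $a,b,c,d$ and relations $ab=qba$, $ac=qca$, $bd=qdb$, $cd=qdc$, $bc=cb$, $ad-da=(q-q^{-1})bc$; its quantum determinant $\Delta=ad-qbc$ is central. The ring $R=A/\langle\Delta\rangle$ is a noetherian domain. An element $p$ of a ring $R$ is normal if $pR=Rp$. *)

(* Defs.v *)
From HB Require Import structures.
From mathcomp Require Import all_boot all_order all_algebra.
From mathcomp Require Import boolp classical_sets cardinality.
From mathcomp Require Import monalg.

Set Implicit Arguments.
Unset Strict Implicit.
Unset Printing Implicit Defensive.

Import GRing.Theory.

Local Open Scope classical_set_scope.
Local Open Scope ring_scope.

Definition is_ideal (R : pzRingType) (I : set R) : Prop :=
  [/\ I 0, forall x y, I x -> I y -> I (x - y)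
    & forall r x, I x -> I (r * x) /\ I (x * r)].

Definition ideal_gen (R : pzRingType) (S : set R) : set R :=
  smallest (@is_ideal R) S.

(* For ideals I and J, the additive span of the products is already an ideal. *)
Definition ideal_mul (R : pzRingType) (I J : set R) : set R :=
  ideal_gen [set x * y | x in I & y in J].

Definition is_prime_ideal (R : pzRingType) (P : set R) : Prop :=
  [/\ is_ideal P, P <> setT
    & forall I J : set R, is_ideal I -> is_ideal J ->
        ideal_mul I J `<=` P -> I `<=` P \/ J `<=` P].

(* Chain P_0 < P_1 < ... < P_n = P of prime ideals; the values of the
   sequence beyond index n are irrelevant. *)
Definition is_prime_chain (R : pzRingType) (P : set R) (n : nat)
    (C : nat -> set R) : Prop :=
  [/\ forall i, (i <= n)%N -> is_prime_ideal (C i),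
      forall i, (i < n)%N -> C i `<` C i.+1
    & C n = P].

Definition has_height (R : pzRingType) (P : set R) (n : nat) : Prop :=
  (exists C, is_prime_chain P n C) /\
  (forall m C, is_prime_chain P m C -> (m <= n)%N).

Definition height1_prime (R : pzRingType) (P : set R) : Prop :=
  is_prime_ideal P /\ has_height P 1.

Definition is_normal (R : pzRingType) (p : R) : Prop :=
  [set p * r | r in [set: R]] = [set r * p | r in [set: R]].

Definition normally_generated (R : pzRingType) (I : set R) : Prop :=
  exists p : R, is_normal p /\ I = ideal_gen [set p].

Section IdealTheory.
Variable R : pzRingType.
Implicit Types (I S : set R).

Lemma is_idealN I x : is_ideal I -> I x -> I (- x).
Proof. by case=> I0 IB _ Ix; rewrite -sub0r; apply: IB. Qed.

Lemma is_idealD I x y : is_ideal I -> I x -> I y -> I (x + y).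
Proof.
by move=> iI Ix Iy; rewrite -[y]opprK; case: (iI) => _ IB _; apply: IB => //;
  apply: is_idealN.
Qed.

Lemma ideal_gen_is_ideal S : is_ideal (ideal_gen S).
Proof.
split=> [J [[]]//|x y Sx Sy J JS|r x Sx].
  by case: (JS) => [[_ IB _] _]; apply: IB; [apply: Sx|apply: Sy].
by split=> J JS; case: (JS) => [[_ _ IM] _]; case: (IM r x (Sx J JS)).
Qed.

Lemma ideal_gen_sub S I : is_ideal I -> S `<=` I -> ideal_gen S `<=` I.
Proof. exact: smallest_sub. Qed.

End IdealTheory.

(* Quotient of a k-algebra by a proper two-sided ideal. Properness is needed
   because the algebras of the library are nonzero by definition. *)

Record proper_bideal (R : pzRingType) := ProperBideal {
  ideal_set :> set R;
  ideal_setP : is_ideal ideal_set;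
  ideal_set1 : ~ ideal_set 1
}.

Section QuotientType.
Variables (k : comNzRingType) (F : algType k) (I : proper_bideal F).

Definition ideal_rel : rel F := fun x y => `[< ideal_set I (x - y) >].

Let iI := ideal_setP I.

Fact ideal_rel_refl : reflexive ideal_rel.
Proof. by move=> x; apply/asboolP; rewrite subrr; case: iI. Qed.

Fact ideal_rel_sym : symmetric ideal_rel.
Proof.
move=> x y; apply/asboolP/asboolP => H;
  by rewrite -opprB; apply: is_idealN.
Qed.

Fact ideal_rel_trans : transitive ideal_rel.
Proof.
move=> y x z /asboolP xy /asboolP yz; apply/asboolP.
by rewrite -(subrKA y); apply: is_idealD.
Qed.

Canonical ideal_equiv :=
  EquivRel ideal_rel ideal_rel_refl ideal_rel_sym ideal_rel_trans.

Definition quot_alg := {eq_quot ideal_equiv}%qT.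

HB.instance Definition _ := Choice.on quot_alg.

Definition quot_repr (u : quot_alg) : F := @repr _ {eq_quot ideal_equiv}%qT u.

End QuotientType.

HB.lock
Definition quot_pi (k : comNzRingType) (F : algType k) (I : proper_bideal F)
  (x : F) : quot_alg I := (\pi_{eq_quot ideal_equiv I} x)%qT.

(* The operations are locked so that unification does not try to compute with
   representatives. *)
HB.lock
Definition quot_add (k : comNzRingType) (F : algType k) (I : proper_bideal F)
  (u v : quot_alg I) : quot_alg I := quot_pi I (quot_repr u + quot_repr v).

HB.lock
Definition quot_opp (k : comNzRingType) (F : algType k) (I : proper_bideal F)
  (u : quot_alg I) : quot_alg I := quot_pi I (- quot_repr u).

HB.lock
Definition quot_mul (k : comNzRingType) (F : algType k) (I : proper_bideal F)
  (u v : quot_alg I) : quot_alg I := quot_pi I (quot_repr u * quot_repr v).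

HB.lock
Definition quot_scale (k : comNzRingType) (F : algType k) (I : proper_bideal F)
  (c : k) (u : quot_alg I) : quot_alg I := quot_pi I (c *: quot_repr u).

Section QuotientAlgebra.
Variables (k : comNzRingType) (F : algType k) (I : proper_bideal F).

Let iI := ideal_setP I.
Local Notation Q := (quot_alg I).
Local Notation qpi := (quot_pi I).
Local Notation rep := (@quot_repr k F I).
Local Notation add := (@quot_add k F I).
Local Notation opp := (@quot_opp k F I).
Local Notation mul := (@quot_mul k F I).
Local Notation scale := (@quot_scale k F I).

Lemma quot_piP x y : qpi x = qpi y <-> ideal_set I (x - y).
Proof.
split=> [/eqP|H]; last apply/eqP.
  by rewrite quot_pi.unlock piE => /asboolP.
by rewrite quot_pi.unlock piE; apply/asboolP.
Qed.

Lemma quot_repK u : qpi (rep u) = u.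
Proof. by rewrite quot_pi.unlock; apply: reprK. Qed.

Lemma quot_ind (T : Q -> Prop) : (forall x, T (qpi x)) -> forall u, T u.
Proof. by move=> H u; rewrite -(quot_repK u). Qed.

Let repP x : ideal_set I (rep (qpi x) - x).
Proof. by apply/quot_piP; rewrite quot_repK. Qed.

Let piD x y : add (qpi x) (qpi y) = qpi (x + y).
Proof.
by rewrite quot_add.unlock; apply/quot_piP; rewrite opprD addrACA; apply: is_idealD.
Qed.

Let piN x : opp (qpi x) = qpi (- x).
Proof. by rewrite quot_opp.unlock; apply/quot_piP; rewrite -opprD; apply: is_idealN. Qed.

Let idMl r x : ideal_set I x -> ideal_set I (r * x).
Proof. by case: iI => _ _ H /(H r)[]. Qed.

Let idMr r x : ideal_set I x -> ideal_set I (x * r).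
Proof. by case: iI => _ _ H /(H r)[]. Qed.

Let piM x y : mul (qpi x) (qpi y) = qpi (x * y).
Proof.
rewrite quot_mul.unlock; apply/quot_piP; set x' := rep _; set y' := rep _.
have -> : x' * y' - x * y = (x' - x) * y' + x * (y' - y).
  by rewrite mulrBl mulrBr addrA subrK.
by apply: (is_idealD iI); [apply: idMr|apply: idMl]; apply: repP.
Qed.

Let piZ c x : scale c (qpi x) = qpi (c *: x).
Proof.
rewrite quot_scale.unlock; apply/quot_piP; rewrite -scalerBr -[_ - _]mul1r scalerAl.
by apply/idMl/repP.
Qed.

Fact quot_addA : associative add.
Proof.
by elim/quot_ind=> x; elim/quot_ind=> y; elim/quot_ind=> z; rewrite !piD addrA.
Qed.
Fact quot_addC : commutative add.
Proof. by elim/quot_ind=> x; elim/quot_ind=> y; rewrite !piD addrC. Qed.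
Fact quot_add0 : left_id (qpi 0) add.
Proof. by elim/quot_ind=> x; rewrite piD add0r. Qed.
Fact quot_addN : left_inverse (qpi 0) opp add.
Proof. by elim/quot_ind=> x; rewrite piN piD addNr. Qed.

HB.instance Definition _ :=
  GRing.isZmodule.Build Q quot_addA quot_addC quot_add0 quot_addN.

Fact quot_mulA : associative mul.
Proof.
by elim/quot_ind=> x; elim/quot_ind=> y; elim/quot_ind=> z; rewrite !piM mulrA.
Qed.
Fact quot_mul1l : left_id (qpi 1) mul.
Proof. by elim/quot_ind=> x; rewrite piM mul1r. Qed.
Fact quot_mul1r : right_id (qpi 1) mul.
Proof. by elim/quot_ind=> x; rewrite piM mulr1. Qed.
Fact quot_mulDl : left_distributive mul add.
Proof.
by elim/quot_ind=> x; elim/quot_ind=> y; elim/quot_ind=> z;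
  rewrite !(piD, piM) mulrDl.
Qed.
Fact quot_mulDr : right_distributive mul add.
Proof.
by elim/quot_ind=> x; elim/quot_ind=> y; elim/quot_ind=> z;
  rewrite !(piD, piM) mulrDr.
Qed.
Fact quot_one_neq0 : qpi 1 != 0 :> Q.
Proof.
by apply/eqP => /quot_piP; rewrite subr0; apply: (@ideal_set1 _ I).
Qed.

HB.instance Definition _ := GRing.Zmodule_isNzRing.Build Q
  quot_mulA quot_mul1l quot_mul1r quot_mulDl quot_mulDr quot_one_neq0.

Fact quot_scaleA a b u : scale a (scale b u) = scale (a * b) u.
Proof. by elim/quot_ind: u => x; rewrite !piZ scalerA. Qed.
Fact quot_scale1 : left_id 1 scale.
Proof. by elim/quot_ind=> x; rewrite piZ scale1r. Qed.
Fact quot_scaleDr : right_distributive scale +%R.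
Proof.
by move=> c; elim/quot_ind=> x; elim/quot_ind=> y;
  rewrite /GRing.add /= !(piD, piZ) scalerDr.
Qed.
Fact quot_scaleDl u : {morph scale^~ u : a b / a + b}.
Proof.
by elim/quot_ind: u => x a b; rewrite !piZ /GRing.add /= piD scalerDl.
Qed.

HB.instance Definition _ := GRing.Zmodule_isLmodule.Build k Q
  quot_scaleA quot_scale1 quot_scaleDr quot_scaleDl.

Fact quot_scaleAl (c : k) (u v : Q) : c *: (u * v) = (c *: u) * v.
Proof.
elim/quot_ind: u => x; elim/quot_ind: v => y.
rewrite /GRing.scale /GRing.mul /=.
by rewrite !(piM, piZ) scalerAl.
Qed.

HB.instance Definition _ := GRing.Lmodule_isLalgebra.Build k Q
  quot_scaleAl.

Fact quot_scaleAr (c : k) (u v : Q) : c *: (u * v) = u * (c *: v).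
Proof.
elim/quot_ind: u => x; elim/quot_ind: v => y.
rewrite /GRing.scale /GRing.mul /=.
by rewrite !(piM, piZ) scalerAr.
Qed.

HB.instance Definition _ := GRing.Lalgebra_isAlgebra.Build k Q
  quot_scaleAr.

Fact quot_pi_zmod_morphism : zmod_morphism qpi.
Proof. by move=> x y; rewrite -piD -piN. Qed.

HB.instance Definition _ :=
  GRing.isZmodMorphism.Build F Q qpi quot_pi_zmod_morphism.

Fact quot_pi_monoid_morphism : monoid_morphism qpi.
Proof. by split=> // x y; rewrite -piM. Qed.

HB.instance Definition _ :=
  GRing.isMonoidMorphism.Build F Q qpi quot_pi_monoid_morphism.

Fact quot_pi_scalable : scalable qpi.
Proof. by move=> c x; rewrite -piZ. Qed.

HB.instance Definition _ :=
  GRing.isScalable.Build k F Q *:%R qpi quot_pi_scalable.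

Lemma quot_pi_ideal (M : set F) : is_ideal M -> is_ideal (qpi @` M).
Proof.
case=> M0 MB MM; split; first by exists 0.
  by move=> _ _ [x Mx <-] [y My <-]; exists (x - y); [apply: MB|rewrite rmorphB].
elim/quot_ind=> r _ [x Mx <-]; have [rx xr] := MM r x Mx.
by split; [exists (r * x)|exists (x * r)] => //; rewrite rmorphM.
Qed.

Lemma quot_pi_proper (M : set F) : is_ideal M -> ideal_set I `<=` M -> ~ M 1 ->
  ~ (qpi @` M) 1.
Proof.
move=> iM IM M1 [x Mx /quot_piP/IM Mx1]; apply: M1.
have [_ MB _] := iM.
by rewrite -[1](subKr x) opprB addrC; apply: is_idealD => //; rewrite -opprB;
  apply: is_idealN.
Qed.

End QuotientAlgebra.

(* The free k-algebra on the entries of a generic 2 x 2 matrix, that is, the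
   monoid algebra of the free monoid on the index pairs. It is given its own
   name because the library declares [algType] on monoid algebras only over
   commutative monoids. *)
Definition free_mx2 (k : comNzRingType) :=
  {malg k[{fmonom ('I_2 * 'I_2)%type}]}.

HB.lock
Definition free_entry (k : comNzRingType) (i j : 'I_2) : free_mx2 k :=
  << fmu (i, j) >>.

Section FreeAlgebra.
Variable k : comNzRingType.

HB.instance Definition _ := GRing.Lalgebra.on (free_mx2 k).

Fact free_mx2_scaleAr (c : k) (x y : free_mx2 k) : c *: (x * y) = x * (c *: y).
Proof.
have cC : c%:MP * x = x * c%:MP.
  rewrite malgM_def fgmulUg [RHS]malgM_def fgmulgU.
  by apply: eq_bigr => m _; rewrite mul1m mulm1 mulrC.
rewrite -(mul_malgC c (x * y)) -(mul_malgC c y) [LHS]mulrA [RHS]mulrA.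
exact: (congr1 (fun z => z * y) cC).
Qed.

HB.instance Definition _ := GRing.Lalgebra_isAlgebra.Build k (free_mx2 k)
  free_mx2_scaleAr.

(* Kernel of the augmentation: polynomials without constant term. *)
Definition free_aug : set (free_mx2 k) := [set x | mcoeff mone x = 0].

Fact free_aug_is_ideal : is_ideal free_aug.
Proof.
have aM (x y : free_mx2 k) : mcoeff mone (x * y) = mcoeff mone x * mcoeff mone y.
  exact: (rmorphM (mcoeff mone)).
rewrite /free_aug; split=> [|x y /= x0 y0|r x /= x0]; first exact: mcoeff0.
  by rewrite mcoeffB x0 y0 subr0.
by split; [rewrite (aM r x) x0 mulr0|rewrite (aM x r) x0 mul0r].
Qed.

Fact free_aug1 : ~ free_aug 1.
Proof. by rewrite /free_aug /= mcoeff1 eqxx => /eqP; rewrite oner_eq0. Qed.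

Fact free_aug_entry i j : free_aug (free_entry k i j).
Proof. by rewrite /free_aug /= free_entry.unlock mcoeffU1 fm1_eq1. Qed.

Fact free_augM x y : free_aug x -> free_aug (x * y).
Proof. by have [_ _ M] := free_aug_is_ideal => /(M y)[]. Qed.

Fact free_augZ c x : free_aug x -> free_aug (c *: x).
Proof. by rewrite /free_aug /= mcoeffZ => ->; rewrite mulr0. Qed.

End FreeAlgebra.

Arguments free_aug k : clear implicits.

Section QuantumMatrices.
Variables (k : fieldType) (q : k).

Let a := free_entry k 0 0.
Let b := free_entry k 0 1.
Let c := free_entry k 1 0.
Let d := free_entry k 1 1.

Definition qmx2_relations : set (free_mx2 k) :=
  [set a * b - q *: (b * a); a * c - q *: (c * a);
       b * d - q *: (d * b); c * d - q *: (d * c);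
       b * c - c * b; a * d - d * a - (q - q^-1) *: (b * c)].

Fact qmx2_relations_aug : qmx2_relations `<=` free_aug k.
Proof.
have [_ augB _] := free_aug_is_ideal k.
have augM i j y : free_aug k (free_entry k i j * y).
  exact/free_augM/free_aug_entry.
move=> x [[[[[->|->]|->]|->]|->]|->].
- by apply: (augB); [|apply: free_augZ]; apply: augM.
- by apply: (augB); [|apply: free_augZ]; apply: augM.
- by apply: (augB); [|apply: free_augZ]; apply: augM.
- by apply: (augB); [|apply: free_augZ]; apply: augM.
- by apply: (augB); apply: augM.
- by apply: (augB); [apply: (augB)|apply: free_augZ]; apply: augM.
Qed.

Fact qmx2_ideal_proper : ~ ideal_gen qmx2_relations 1.
Proof.
move=> H; apply: (@free_aug1 k); move: H; apply: ideal_gen_sub.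
  exact: free_aug_is_ideal.
exact: qmx2_relations_aug.
Qed.

Definition qmx2_ideal : proper_bideal (free_mx2 k) :=
  ProperBideal (ideal_gen_is_ideal qmx2_relations) qmx2_ideal_proper.

(* O_q(M_2(k)) *)
Definition qmx2 := quot_alg qmx2_ideal.

HB.instance Definition _ := GRing.Algebra.on qmx2.

Definition qmx2_a : qmx2 := quot_pi qmx2_ideal a.
Definition qmx2_b : qmx2 := quot_pi qmx2_ideal b.
Definition qmx2_c : qmx2 := quot_pi qmx2_ideal c.
Definition qmx2_d : qmx2 := quot_pi qmx2_ideal d.

Definition qdet : qmx2 := qmx2_a * qmx2_d - q *: (qmx2_b * qmx2_c).

Fact qdet_ideal_proper : ~ ideal_gen [set qdet] 1.
Proof.
have iM := free_aug_is_ideal k.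
have IM : ideal_set qmx2_ideal `<=` free_aug k.
  by apply: ideal_gen_sub => //; apply: qmx2_relations_aug.
move=> H; apply: (quot_pi_proper iM IM (@free_aug1 k)); move: H.
apply: ideal_gen_sub; first exact: quot_pi_ideal.
move=> _ ->; exists (a * d - q *: (b * c)).
  have [_ augB _] := iM.
  by apply: augB; [|apply: free_augZ]; apply/free_augM/free_aug_entry.
by rewrite linearB linearZ; congr (_ - _ *: _); apply: rmorphM.
Qed.

Definition qdet_ideal : proper_bideal qmx2 :=
  ProperBideal (ideal_gen_is_ideal [set qdet]) qdet_ideal_proper.

(* O_q(M_2(k)) / <Delta> *)
Definition qmx2_mod_det := quot_alg qdet_ideal.

HB.instance Definition _ := GRing.Algebra.on qmx2_mod_det.

(* J / <Delta>, for an ideal J of O_q(M_2(k)) containing Delta. *)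
Definition ideal_mod_det (J : set qmx2) : set qmx2_mod_det :=
  quot_pi qdet_ideal @` J.

End QuantumMatrices.

(* Main.v *)
(* Let a, b, c, d be the generators of R. As ad and da are scalar multiples of
   bc, the monomials b^i c^j a^m and b^i c^j d^m span R, and they quasi-commute
   with a and c. Iterating y |-> z y - t y z with z = c and z = a isolates, in
   any ideal, the components of an element: from an element x <> 0 one obtains a
   nonzero form H(b, c), depending on x only, such that every ideal containing x
   contains H(b, c) (bc)^N c^n for some N and n. Over an algebraically closed
   field H splits into factors b - t c and c, which are normal; hence a nonzero
   prime contains b - t c for some t <> 0, or else b or c, and in the latter
   case also ad and therefore a or d. So it contains one of the listed ideals.
   The same extraction, carried out in the quotients, shows that the listed
   ideals are prime: nonzero ideals of the quotient contain monomials, and no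
   monomial vanishes, by finite dimensional representations in which one
   generator is a geometric diagonal matrix and another one a nilpotent shift.
   The form H vanishes at finitely many t only, so x <> 0 lies in finitely many
   of the primes <b - t c>, and 0 is prime as well. Finally
   <a, b> and the three other ideals have two generators that stay independent
   modulo the square of the augmentation ideal, so they are not principal. *)
Require Import Defs.
From HB Require Import structures.
From mathcomp Require Import all_boot all_order all_algebra.
From mathcomp Require Import boolp classical_sets cardinality.
From mathcomp Require Import monalg.

Set Implicit Arguments.
Unset Strict Implicit.
Unset Printing Implicit Defensive.

Import GRing.Theory.

Local Open Scope classical_set_scope.
Local Open Scope ring_scope.

(** * Generation of algebras and the relations of R *)

(** Generation is encoded as the induction principle it yields: elements are combinations of words,
    and words grow by a generator on the left. *)
Definition alg_gen (k : pzRingType) (T : lalgType k) (G : set T) : Prop :=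
  forall Q : T -> Prop, Q 1 -> (forall x y, Q x -> Q y -> Q (x + y)) ->
    (forall e x, Q x -> Q (e *: x)) ->
    (forall g x, G g -> Q x -> Q (g * x)) -> forall x, Q x.

(** The defining relations after [Delta] is set to 0: since [ad = q bc], the commutator relation
    becomes [da = q^-1 bc]. *)
Definition qmx2_det0_rels (k : fieldType) (q : k) (T : algType k)
    (a b c d : T) : Prop :=
  [/\ a * b = q *: (b * a), a * c = q *: (c * a), b * d = q *: (d * b),
      c * d = q *: (d * c)
    & [/\ b * c = c * b, a * d = q *: (b * c) & d * a = q^-1 *: (b * c)]].

Lemma ker_is_ideal (k : comNzRingType) (S T : algType k)
  (f : {lrmorphism S -> T}) : is_ideal [set x | f x = 0].
Proof.
split=> /= [|x y fx fy|r x fx]; first exact: rmorph0.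
  by rewrite rmorphB /= fx fy subrr.
by rewrite !rmorphM /= fx mulr0 mul0r.
Qed.

Lemma lrmorphBZ (k : comNzRingType) (S T : algType k) (f : {lrmorphism S -> T})
  e x y : f (x - e *: y) = f x - e *: f y.
Proof. by rewrite rmorphB [X in _ - X]linearZ. Qed.

Lemma lrmorphMZ (k : comNzRingType) (S T : algType k) (f : {lrmorphism S -> T})
  e x y z w : f (x * y - e *: (z * w)) = f x * f y - e *: (f z * f w).
Proof. by rewrite rmorphB [X in _ - X]linearZ /= !rmorphM. Qed.

Lemma lrmorphMMZ (k : comNzRingType) (S T : algType k)
  (f : {lrmorphism S -> T}) e x y z w u v :
  f (x * y - z * w - e *: (u * v)) = f x * f y - f z * f w - e *: (f u * f v).
Proof.
rewrite addrAC; have -> : f (x * y - e *: (u * v) - z * w) =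
  f (x * y - e *: (u * v)) - f (z * w) by exact: rmorphB.
by rewrite lrmorphMZ rmorphM addrAC.
Qed.

Lemma lrmorph_rel (k : comNzRingType) (S T : algType k)
  (f : {lrmorphism S -> T}) e x y z w :
  f (x * y - e *: (z * w)) = 0 -> f x * f y = e *: (f z * f w).
Proof. by rewrite lrmorphMZ => /eqP; rewrite subr_eq0 => /eqP. Qed.

Lemma qmx2_det0_rels_morph (k : fieldType) (q : k) (S T : algType k)
  (f : {lrmorphism S -> T}) a b c d :
  qmx2_det0_rels q a b c d -> qmx2_det0_rels q (f a) (f b) (f c) (f d).
Proof.
case=> ab ac bd cd [bc ad da].
have fM e x y z w : x * y = e *: (z * w) -> f x * f y = e *: (f z * f w).
  by move=> xy; apply: lrmorph_rel; rewrite xy subrr rmorph0.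
by split; [| | | |split]; try exact: fM; rewrite -!rmorphM bc.
Qed.

(** * Universal properties of quotients and of the free algebra *)

Section QuotientLift.
Variables (k : comNzRingType) (F : algType k) (I : proper_bideal F).
Variables (T : algType k) (f : {lrmorphism F -> T}).
Hypothesis fI : forall x, ideal_set I x -> f x = 0.

Definition quot_lift (u : quot_alg I) : T := f (quot_repr u).

Lemma quot_lift_pi x : quot_lift (quot_pi I x) = f x.
Proof.
apply/eqP; rewrite -subr_eq0 -rmorphB; apply/eqP/fI.
by apply/quot_piP; rewrite quot_repK.
Qed.

Lemma quot_lrmorphism_lift :
  exists g : {lrmorphism quot_alg I -> T}, forall x, g (quot_pi I x) = f x.
Proof.
have gB : zmod_morphism quot_lift.
  elim/quot_ind=> x; elim/quot_ind=> y.
  by rewrite -rmorphB !quot_lift_pi rmorphB.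
have gM : monoid_morphism quot_lift.
  split; first by rewrite -(rmorph1 (quot_pi I)) quot_lift_pi rmorph1.
  elim/quot_ind=> x; elim/quot_ind=> y.
  by rewrite -rmorphM !quot_lift_pi rmorphM.
have gZ : scalable quot_lift.
  by move=> e; elim/quot_ind=> x; rewrite -linearZ !quot_lift_pi linearZ.
(* The structures rest on the hypothesis [fI], so they are packed here for this one map. *)
pose gBi := GRing.isZmodMorphism.Build _ _ _ gB.
pose gMi := GRing.isMonoidMorphism.Build _ _ _ gM.
pose gZi := GRing.isScalable.Build _ _ _ _ _ gZ.
pose g : {lrmorphism quot_alg I -> T} := HB.pack quot_lift gBi gMi gZi.
by exists g => x; exact: quot_lift_pi.
Qed.

End QuotientLift.

Section FreeLift.
Variables (k : comNzRingType) (T : algType k) (g : 'I_2 * 'I_2 -> T).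

Definition fmonom_eval (m : {fmonom ('I_2 * 'I_2)%type}) : T :=
  \prod_(i <- m) g i.

Fact fmonom_eval_mmorphism : mmorphism fmonom_eval.
Proof.
by split=> [m1 m2|]; rewrite /fmonom_eval ?fmM ?big_cat // fm1 big_nil.
Qed.

HB.instance Definition _ :=
  monalg.isMultiplicative.Build _ _ fmonom_eval fmonom_eval_mmorphism.

Definition free_lift (x : free_mx2 k) : T := mmap (in_alg T) fmonom_eval x.

Fact free_lift_zmod_morphism : zmod_morphism free_lift.
Proof. by move=> x y; rewrite /free_lift mmapB. Qed.

Fact free_lift_monoid_morphism : monoid_morphism free_lift.
Proof.
(* Multiplicativity of [mmap] asks that images of coefficients commute with images of words; scalars
   do. *)
have cfh (h : free_mx2 k) (m m' : {fmonom ('I_2 * 'I_2)%type}) :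
  GRing.comm (in_alg T (mcoeff m h)) (fmonom_eval m').
  by rewrite /GRing.comm /= mulr_algl mulr_algr.
by have [M1 M2] := commr_mmap_is_multiplicative cfh; split.
Qed.

Fact free_lift_scalable : scalable free_lift.
Proof. by move=> e x; rewrite /free_lift mmapZ /= mulr_algl. Qed.

HB.instance Definition _ := GRing.isZmodMorphism.Build
  (free_mx2 k) T free_lift free_lift_zmod_morphism.
HB.instance Definition _ := GRing.isMonoidMorphism.Build
  (free_mx2 k) T free_lift free_lift_monoid_morphism.
HB.instance Definition _ := GRing.isScalable.Build
  k (free_mx2 k) T *:%R free_lift free_lift_scalable.

Lemma free_lift_entry i j : free_lift (free_entry k i j) = g (i, j).
Proof.
rewrite free_entry.unlock /free_lift mmapU /= scale1r mul1r /fmonom_eval fmU.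
by rewrite big_seq1.
Qed.

End FreeLift.

(** An element is a finite combination of words, and a nonempty word is its first letter times a
    shorter word. *)
Lemma free_mx2_gen (k : comNzRingType) (Q : free_mx2 k -> Prop) :
  Q 1 -> (forall x y, Q x -> Q y -> Q (x + y)) ->
  (forall e x, Q x -> Q (e *: x)) ->
  (forall i j x, Q x -> Q (free_entry k i j * x)) -> forall x, Q x.
Proof.
move=> Q1 QD QZ QM x.
have Q0 : Q 0 by rewrite -(scale0r (1 : free_mx2 k)); apply: QZ.
have Qm (m : {fmonom ('I_2 * 'I_2)%type}) : Q (<< m >> : {malg k[_]}).
  case: m => s; elim: s => [|[i j] s IHs].
    suff -> : (<< FMonom [::] >> : {malg k[{fmonom ('I_2 * 'I_2)%type}]}) = 1
      by [].
    by rewrite -fmoneE.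
  have -> : (<< FMonom ((i, j) :: s) >> : free_mx2 k) =
            free_entry k i j * (<< FMonom s >> : free_mx2 k).
    rewrite free_entry.unlock; set m := FMonom s.
    have -> : FMonom ((i, j) :: s) = mmul (fmu (i, j)) m.
      by apply/eqP; rewrite fmP fmM fmU.
    by rewrite malgM_def fgmulUU mulr1.
  exact: QM.
rewrite [x]monalgE; elim/big_ind: _ => // m _.
have -> : (<< mcoeff m x *g m >> : free_mx2 k) =
    mcoeff m x *: (<< m >> : free_mx2 k).
  by apply/malgP=> m'; rewrite mcoeffZ !mcoeffU mulrnAr mulr1.
exact: QZ.
Qed.

(** * Presentation of R by generators and relations *)

Section ModDetPresentation.
Variables (k : fieldType) (q : k).

Local Notation R := (qmx2_mod_det q).
Local Notation rpi := (quot_pi (qdet_ideal q)).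
Let a : R := rpi (qmx2_a q).
Let b : R := rpi (qmx2_b q).
Let c : R := rpi (qmx2_c q).
Let d : R := rpi (qmx2_d q).

Lemma qmx2_mod_det_gen : alg_gen [set a; b; c; d].
Proof.
move=> Q Q1 QD QZ QM.
elim/quot_ind; elim/quot_ind.
apply: free_mx2_gen.
- by rewrite !rmorph1.
- by move=> x y Qx Qy; rewrite !rmorphD; apply: QD.
- by move=> e x Qx; rewrite !linearZ; apply: QZ.
move=> i j x Qx; rewrite !rmorphM; apply: QM => //.
case: i j => [[|[|//]] ?] [[|[|//]] ?].
- by left; left; left; congr (rpi (quot_pi _ (free_entry _ _ _))); apply: val_inj.
- by left; left; right; congr (rpi (quot_pi _ (free_entry _ _ _))); apply: val_inj.
- by left; right; congr (rpi (quot_pi _ (free_entry _ _ _))); apply: val_inj.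
- by right; congr (rpi (quot_pi _ (free_entry _ _ _))); apply: val_inj.
Qed.

Let qrel x : qmx2_relations q x -> quot_pi (qmx2_ideal q) x = 0.
Proof.
move=> qx; rewrite -(rmorph0 (quot_pi (qmx2_ideal q))).
apply/quot_piP; rewrite subr0.
by have : ideal_gen (qmx2_relations q) x by move=> J [_]; apply.
Qed.

Lemma qmx2_mod_det_rels : qmx2_det0_rels q a b c d.
Proof.
have morphZ e x y : x = e *: y -> rpi x = e *: rpi y by move=> ->; exact: linearZ.
have det0 : rpi (qdet q) = 0.
  rewrite -(rmorph0 rpi); apply/quot_piP; rewrite subr0.
  by have : ideal_gen [set qdet q] (qdet q) by move=> J [_]; apply.
have relR e (x y z w : qmx2 q) : x * y = e *: (z * w) ->
    rpi x * rpi y = e *: (rpi z * rpi w).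
  by move=> xy; rewrite -!rmorphM; apply: morphZ.
have ad : a * d = q *: (b * c) by apply: (lrmorph_rel (f := rpi)).
split; last split=> //.
- by apply/relR/lrmorph_rel/qrel; do 5!left.
- by apply/relR/lrmorph_rel/qrel; do 4!left; right.
- by apply/relR/lrmorph_rel/qrel; do 3!left; right.
- by apply/relR/lrmorph_rel/qrel; do 2!left; right.
- rewrite -[RHS]scale1r; apply/relR/lrmorph_rel; rewrite scale1r; apply: qrel.
  by left; right.
(* With [ad = q bc], the commutator relation reads [q bc - da = q bc - q^-1 bc]; cancelling gives
   [da]. *)
pose e := q - q^-1.
have : qmx2_a q * qmx2_d q - qmx2_d q * qmx2_a q = e *: (qmx2_b q * qmx2_c q).
  apply/eqP; rewrite -subr_eq0; apply/eqP.
  by rewrite -(lrmorphMMZ (quot_pi (qmx2_ideal q))); apply: qrel; right.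
move/morphZ; rewrite rmorphB !rmorphM -/a -/b -/c -/d ad scalerBl.
by move=> /addrI/oppr_inj.
Qed.

(** Universal property of R: the relations are checked first in the free algebra, then for the
    determinant. It supplies the representations that show elements to lie outside given ideals. *)
Lemma qmx2_mod_det_lift (T : algType k) (A B C D : T) :
  qmx2_det0_rels q A B C D ->
  exists f : {lrmorphism R -> T}, [/\ f a = A, f b = B, f c = C & f d = D].
Proof.
case=> AB AC BD CD [BC AD DA].
pose g (ij : 'I_2 * 'I_2) : T :=
  if ij.1 == 0 then (if ij.2 == 0 then A else B) else (if ij.2 == 0 then C else D).
pose f0 : {lrmorphism free_mx2 k -> T} := free_lift g.
have f0E i j : f0 (free_entry k i j) = g (i, j) by exact: free_lift_entry.
have fr x : qmx2_relations q x -> f0 x = 0.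
  case=> [[[[[->|->]|->]|->]|->]|->].
  - by rewrite lrmorphMZ !f0E /g /= AB subrr.
  - by rewrite lrmorphMZ !f0E /g /= AC subrr.
  - by rewrite lrmorphMZ !f0E /g /= BD subrr.
  - by rewrite lrmorphMZ !f0E /g /= CD subrr.
  - by rewrite -[X in _ - X]scale1r lrmorphMZ !f0E /g /= scale1r BC subrr.
  rewrite lrmorphMMZ !f0E /g /= AD DA scalerBl.
  by rewrite opprB addrA subrK subrr.
have [f1 f1E] := quot_lrmorphism_lift (I := qmx2_ideal q)
   (ideal_gen_sub (ker_is_ideal f0) fr).
have det0 : [set qdet q] `<=` [set x | f1 x = 0].
  by move=> _ -> /=; rewrite /qdet lrmorphMZ !f1E !f0E /g /= AD subrr.
have [f fE] := quot_lrmorphism_lift (I := qdet_ideal q)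
   (ideal_gen_sub (ker_is_ideal f1) det0).
by exists f; split; rewrite fE f1E f0E.
Qed.

End ModDetPresentation.

(** * Ideals, and the extraction of components by twist *)

Section Ideals.
Variables (k : comNzRingType) (T : algType k).
Implicit Types (J : set T).

Lemma is_ideal0 J : is_ideal J -> J 0.
Proof. by case. Qed.

Lemma is_idealB J x y : is_ideal J -> J x -> J y -> J (x - y).
Proof. by case=> _ JB _; apply: JB. Qed.

Lemma is_idealMl J r x : is_ideal J -> J x -> J (r * x).
Proof. by case=> _ _ JM /(JM r)[]. Qed.

Lemma is_idealMr J r x : is_ideal J -> J x -> J (x * r).
Proof. by case=> _ _ JM /(JM r)[]. Qed.

Lemma is_idealZ J e x : is_ideal J -> J x -> J (e *: x).
Proof. by move=> iJ Jx; rewrite -[x]mul1r scalerAl; apply: is_idealMl. Qed.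

Lemma sub_ideal_gen (S : set T) : S `<=` ideal_gen S.
Proof. by move=> x Sx J [_]; apply. Qed.

End Ideals.

Lemma is_idealZV (k : fieldType) (T : algType k) (J : set T) e x :
  is_ideal J -> e != 0 -> J (e *: x) -> J x.
Proof.
by move=> iJ e0 /(is_idealZ e^-1 iJ); rewrite scalerA mulVf // scale1r.
Qed.

Section TwistFilter.
Variables (k : fieldType) (T : algType k) (J : set T) (I : eqType).
Hypothesis iJ : is_ideal J.

(* Bracketing with z, that is y |-> z y - t y z, multiplies the component of
   twist tau by (tau - t): this isolates the components of a given twist. *)
Lemma twist_filter (s : seq I) (x : I -> T) (tau : I -> k) (z : T) (t0 : k) :
  (forall p, z * x p = tau p *: (x p * z)) -> J (\sum_(p <- s) x p) ->
  exists n, J (\sum_(p <- s | tau p == t0) x p * z ^+ n).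
Proof.
move=> zx Jx.
have key (L : seq k) :
    J (\sum_(p <- s) (\prod_(t <- L) (tau p - t)) *: (x p * z ^+ size L)).
  elim: L => [|t L IHL].
    by under eq_bigr do rewrite big_nil scale1r mulr1.
  set y := \sum_(p <- s) _ in IHL.
  rewrite [X in J X](_ : _ = z * y - t *: (y * z)); last first.
    rewrite /y mulr_sumr mulr_suml scaler_sumr -sumrB; apply: eq_bigr => p _.
    rewrite big_cons -scalerAr -scalerAl mulrA zx !scalerA -scalerAl scalerA.
    by rewrite -!mulrA -exprS -exprSr -scalerBl mulrBl [t * _]mulrC [tau p * _]mulrC.
  apply: is_idealB => //; first exact: is_idealMl.
  by apply: is_idealZ => //; apply: is_idealMr.
(* Bracketing with all the other twists kills every term of twist different from [t0] and multiplies
   the remaining ones by a common nonzero scalar. *)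
pose L := [seq tau p | p <- s & tau p != t0].
exists (size L); have e0 : \prod_(t <- L) (t0 - t) != 0.
  rewrite prodf_seq_neq0; apply/allP => t /mapP[p]; rewrite mem_filter.
  by case/andP => pt _ ->; rewrite /= subr_eq0 eq_sym.
apply: (is_idealZV iJ e0); move: (key L).
rewrite (bigID (fun p => tau p == t0)) /= [X in _ + X](_ : _ = 0) ?addr0.
  by rewrite scaler_sumr; under eq_bigr => p /eqP -> do [].
rewrite big_seq_cond big1 // => p /andP[ps pt].
suff -> : \prod_(t <- L) (tau p - t) = 0 by rewrite scale0r.
apply/eqP; rewrite prodf_seq_eq0; apply/hasP; exists (tau p); last by rewrite /= subrr.
by apply: map_f; rewrite mem_filter pt.
Qed.

End TwistFilter.

Section QCommute.
Variables (k : fieldType) (T : algType k) (e : k) (z w : T).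
Hypothesis wz : w * z = e *: (z * w).

Lemma qcommXr j : w * z ^+ j = e ^+ j *: (z ^+ j * w).
Proof.
elim: j => [|j IHj]; first by rewrite !expr0 scale1r mul1r mulr1.
rewrite [z ^+ j.+1]exprS mulrA wz -scalerAl -[z * w * _]mulrA IHj -scalerAr.
by rewrite scalerA mulrA -!exprS.
Qed.

Lemma qcommXl i : w ^+ i * z = e ^+ i *: (z * w ^+ i).
Proof.
elim: i => [|i IHi]; first by rewrite !expr0 scale1r mul1r mulr1.
rewrite [w ^+ i.+1]exprSr -[_ * w * z]mulrA wz -scalerAr [w ^+ i * (z * w)]mulrA IHi.
by rewrite -scalerAl scalerA -[z * _ * w]mulrA -exprS.
Qed.

End QCommute.

Lemma qcommXX (k : fieldType) (T : algType k) (e : k) (z w : T) i j :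
  w * z = e *: (z * w) -> w ^+ i * z ^+ j = e ^+ (i * j) *: (z ^+ j * w ^+ i).
Proof. by move=> wz; rewrite (qcommXr (qcommXl wz i)) exprM. Qed.

Lemma qcomm_monoM (k : fieldType) (T : algType k) (e : k) (z w : T) i j n m :
  w * z = e *: (z * w) ->
  (z ^+ i * w ^+ j) * (z ^+ n * w ^+ m) =
    e ^+ (j * n) *: (z ^+ (i + n) * w ^+ (j + m)).
Proof.
move=> wz; rewrite -mulrA [w ^+ j * (z ^+ n * _)]mulrA (qcommXX _ _ wz).
by rewrite -scalerAl -scalerAr; congr (_ *: _); rewrite !exprD !mulrA.
Qed.

Lemma qcommM (k : fieldType) (T : algType k) (e1 e2 : k) (z w1 w2 : T) :
  z * w1 = e1 *: (w1 * z) -> z * w2 = e2 *: (w2 * z) ->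
  z * (w1 * w2) = (e1 * e2) *: (w1 * w2 * z).
Proof.
move=> zw1 zw2; rewrite mulrA zw1 -scalerAl -[w1 * z * w2]mulrA zw2 -scalerAr.
by rewrite scalerA mulrA.
Qed.

Lemma qcommV (k : fieldType) (T : algType k) (e : k) (z w : T) :
  e != 0 -> w * z = e *: (z * w) -> z * w = e^-1 *: (w * z).
Proof. by move=> e0 ->; rewrite scalerA mulVf // scale1r. Qed.

(** Two filters in a row. The first leaves a factor [z ^+ n] on each term, which multiplies the
    twist against [w] by [e ^+ n]; the second filter therefore aims at [s0 * e ^+ n]. *)
Lemma twist_filter2 (k : fieldType) (T : algType k) (J : set T) (I : eqType)
    (s : seq I) (x : I -> T) (tau sigma : I -> k) (z w : T) (e t0 s0 : k) :
  is_ideal J -> e != 0 -> w * z = e *: (z * w) ->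
  (forall p, z * x p = tau p *: (x p * z)) ->
  (forall p, w * x p = sigma p *: (x p * w)) -> J (\sum_(p <- s) x p) ->
  exists n m, J (\sum_(p <- s | (tau p == t0) && (sigma p == s0))
    x p * z ^+ n * w ^+ m).
Proof.
move=> iJ e0 wz zx wx /(twist_filter iJ t0 zx)[n]; rewrite -big_filter => Jx.
have wx' p : w * (x p * z ^+ n) = (sigma p * e ^+ n) *: (x p * z ^+ n * w).
  by rewrite mulrA wx -scalerAl -[x p * w * _]mulrA (qcommXr wz) -scalerAr scalerA mulrA.
have [m Jm] := twist_filter iJ (s0 * e ^+ n) wx' Jx.
exists n, m; move: Jm; rewrite big_filter_cond.
congr (J _); apply: eq_bigl => p; congr (_ && _).
by rewrite (inj_eq (mulIf _)) // expf_neq0.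
Qed.

(** * Prime rings and prime ideals in terms of elements *)

Definition prime_ring (T : pzRingType) :=
  forall x y : T, (forall r, x * r * y = 0) -> x = 0 \/ y = 0.

(** If [xRy = 0] with [x], [y] nonzero, the ideal of all [u] with [uRy = 0] contains [x], hence some
    [u] in [M]; then the ideal of all [v] with [uRv = 0] contains [y], hence some [v] in [M], and
    [uv = 0] is excluded. *)
Lemma prime_ring_msystem (T : nzRingType) (M : set T) :
  (forall (J : set T) x, is_ideal J -> J x -> x <> 0 -> exists2 u, M u & J u) ->
  (forall u v, M u -> M v -> u * v <> 0) -> prime_ring T.
Proof.
move=> JM MM x y xy.
have [->|x0] := pselect (x = 0); [by left|right].
apply: contrapT => y0.
have iI : is_ideal [set u | forall r, u * r * y = 0].
  split=> /= [r|u v u0 v0 r|s u u0]; first by rewrite !mul0r.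
    by rewrite !mulrBl u0 v0 subrr.
  by split=> r; [rewrite -[s * u * r]mulrA -[LHS]mulrA u0 mulr0
    |rewrite -[u * s * r]mulrA u0].
have [u Mu /= uy] := JM _ _ iI xy x0.
have iJ : is_ideal [set v | forall r, u * r * v = 0].
  split=> /= [r|v v' v0 v'0 r|s v v0]; first by rewrite mulr0.
    by rewrite mulrBr v0 v'0 subrr.
  by split=> r; [rewrite mulrA -[u * r * s]mulrA v0|rewrite mulrA v0 mul0r].
have [v Mv /= uv] := JM _ _ iJ uy y0.
by apply: (MM u v Mu Mv); rewrite -[u]mulr1 uv.
Qed.

Lemma prime_ring_quotient (R S : nzRingType) (K : set R) (f : R -> S) :
  (forall x y, f (x * y) = f x * f y) -> (forall u, exists x, f x = u) ->
  (forall x, K x <-> f x = 0) -> is_ideal K -> ~ K 1 ->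
  prime_ring S -> is_prime_ideal K.
Proof.
move=> fM fS Kf iK K1 pS; split=> // [KT|I J iI iJ IJ]; first by apply: K1; rewrite KT.
apply: contrapT => /not_orP[/existsNP[x /not_implyP[Ix Kx]]].
move=> /existsNP[y /not_implyP[Jy Ky]].
have [r|/Kf //|/Kf //] := pS (f x) (f y).
have [z <-] := fS r; rewrite -!fM; apply/Kf/IJ.
move=> L [iL LIJ]; apply: LIJ; rewrite -mulrA; exists x => //.
by exists (z * y) => //; case: iJ => _ _ /(_ z y Jy)[].
Qed.

(** The sets [I] of all [u] with [uRy] in [P], and [J] of all [v] with [IRv] in [P], are ideals with
    product in [P]. The first contains [x], the second [y]. *)
Lemma prime_ideal_elem (R : pzRingType) (P : set R) x y : is_prime_ideal P ->
  (forall r, P (x * r * y)) -> P x \/ P y.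
Proof.
case=> iP _ PP Pxy; have [P0 PB PM] := iP.
pose I := [set u | forall r, P (u * r * y)].
pose J := [set v | forall u r, I u -> P (u * r * v)].
have iI : is_ideal I.
  split=> /= [r|u v u0 v0 r|s u u0]; first by rewrite !mul0r.
    by rewrite !mulrBl; apply: PB.
  split=> r; last by rewrite -[u * s * r]mulrA; apply: u0.
  by rewrite -!mulrA; have [+ _] := PM s _ (u0 r); rewrite -!mulrA.
have iJ : is_ideal J.
  split=> /= [u r _|v v' v0 v'0 u r Iu|s v v0]; first by rewrite mulr0.
    by rewrite mulrBr; apply: PB; [apply: v0|apply: v'0].
  split=> u r Iu; first by rewrite mulrA -[u * r * s]mulrA; apply: v0.
  by rewrite mulrA; have [_ ] := PM s _ (v0 u r Iu).
have [] := PP I J iI iJ; last 2 first.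
- by move=> IP; left; apply: IP.
- by move=> JP; right; apply: JP => u r; apply.
apply: ideal_gen_sub => // _ [u Iu [v Jv <-]].
by rewrite -[u]mulr1; apply: Jv.
Qed.

(** * Spanning families and a primeness criterion *)

Section Span.
Variables (k : fieldType) (T : algType k) (G : set T) (I : eqType) (u : I -> T).
Hypothesis genG : alg_gen G.
Hypothesis u1 : exists p, u p = 1.
Hypothesis Gu : forall g p, G g -> exists e p', g * u p = e *: u p'.

(** The family contains 1 and is stable, up to scalars, under left multiplication by generators.
    Coefficients of equal indices are collected, so that later a single index can be isolated. *)
Lemma alg_gen_span x : exists (s : seq I) (al : I -> k),
  uniq s /\ x = \sum_(p <- s) al p *: u p.
Proof.
suff [l ->] : exists l : seq (k * I), x = \sum_(t <- l) t.1 *: u t.2.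
  exists (undup [seq t.2 | t <- l]), (fun p => \sum_(t <- l | t.2 == p) t.1).
  split; first exact: undup_uniq.
  under [RHS]eq_bigr do rewrite scaler_suml big_mkcond.
  rewrite exchange_big /= big_seq [RHS]big_seq; apply: eq_bigr => t lt.
  rewrite (bigD1_seq t.2) ?undup_uniq ?mem_undup ?map_f //= eqxx.
  by rewrite big1 ?addr0 // => p; rewrite eq_sym => /negPf ->.
elim/genG: x => [|x y [l ->] [l' ->]|e x [l ->]|g x Gg [l ->]].
- by have [p up] := u1; exists [:: (1, p)]; rewrite big_seq1 up scale1r.
- by exists (l ++ l'); rewrite big_cat.
- exists [seq (e * t.1, t.2) | t <- l]; rewrite big_map scaler_sumr.
  by apply: eq_bigr => t _; rewrite scalerA.
elim: l => [|t l [l' IHl]]; first by exists [::]; rewrite !big_nil mulr0.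
have [e [p gu]] := Gu t.2 Gg.
exists ((t.1 * e, p) :: l'); rewrite !big_cons mulrDr IHl -scalerAr gu.
by rewrite scalerA.
Qed.

Lemma alg_gen_span_neq0 x : x <> 0 -> exists (s : seq I) (al : I -> k) p0,
  [/\ uniq s, x = \sum_(p <- s) al p *: u p, p0 \in s & al p0 != 0].
Proof.
have [s [al [us xE]]] := alg_gen_span x => x0.
suff /hasP[p0 sp0 alp0] : has (fun p => al p != 0) s by exists s, al, p0.
apply/negP => /negP/hasPn al0; apply: x0; rewrite xE big_seq big1 // => p ps.
by move/negbNE/eqP: (al0 p ps) => ->; rewrite scale0r.
Qed.

End Span.

(** The two twists together determine the index, so filtering by those of an index with nonzero
    coefficient leaves one term [u p * z ^+ n * w ^+ m] in the ideal. Every nonzero ideal thus meets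
    [M]. *)
Lemma prime_ring_twisted (k : fieldType) (T : algType k) (G : set T)
    (I : eqType) (u : I -> T) (tau sigma : I -> k) (z w : T) (e : k)
    (M : set T) :
  alg_gen G -> (exists p, u p = 1) ->
  (forall g p, G g -> exists e p', g * u p = e *: u p') ->
  e != 0 -> w * z = e *: (z * w) ->
  (forall p, z * u p = tau p *: (u p * z)) ->
  (forall p, w * u p = sigma p *: (u p * w)) ->
  (forall p p', tau p = tau p' -> sigma p = sigma p' -> p = p') ->
  (forall (J : set T) p n m, is_ideal J -> J (u p * z ^+ n * w ^+ m) ->
    exists2 v, M v & J v) ->
  (forall v v', M v -> M v' -> v * v' <> 0) -> prime_ring T.
Proof.
move=> genG u1 Gu e0 wz zu wu tinj JM MM.
apply: (prime_ring_msystem _ MM) => J x iJ Jx x0.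
have [s [al [p0 [us xE sp0 al0]]]] := alg_gen_span_neq0 genG u1 Gu x0.
have zx p : z * (al p *: u p) = tau p *: (al p *: u p * z).
  by rewrite -scalerAr zu -scalerAl !scalerA mulrC.
have wx p : w * (al p *: u p) = sigma p *: (al p *: u p * w).
  by rewrite -scalerAr wu -scalerAl !scalerA mulrC.
rewrite xE in Jx.
have [n [m]] := twist_filter2 (tau p0) (sigma p0) iJ e0 wz zx wx Jx.
rewrite big_mkcond (bigD1_seq p0) //= !eqxx big1_seq ?addr0 /=; last first.
  move=> p /andP[pp0 _]; case: eqP => //= tp; case: eqP => // sp.
  by rewrite (tinj _ _ tp sp) eqxx in pp0.
rewrite -!scalerAl => /(is_idealZV iJ al0); exact: JM.
Qed.

(** * Powers of q, and quantum planes *)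

Section RootOfUnity.
Variables (k : fieldType) (q : k).
Hypothesis hq0 : q != 0.
Hypothesis hq : forall n : nat, (0 < n)%N -> q ^+ n != 1.

Lemma expr_nonunity_inj i j : q ^+ i = q ^+ j -> i = j.
Proof.
wlog ij : i j / (i <= j)%N.
  by move=> H; case: (leqP i j) => [/H//|/ltnW/H{}H /esym/H].
rewrite -(subnKC ij) exprD -[LHS]mulr1 => /(mulfI (expf_neq0 _ hq0)) /esym/eqP E.
case: (posnP (j - i)) => [->|/hq]; first by rewrite addn0.
by rewrite E.
Qed.

Lemma exprz_nonunity_inj (m n : int) : q ^ m = q ^ n -> m = n.
Proof.
move=> mn; apply/eqP; rewrite -subr_eq0.
have : q ^ (m - n) = 1 by rewrite expfzDr // mn -expfzDr // subrr expr0z.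
case: (m - n) => [[|j]|j] //= H; first by have := hq (ltn0Sn j); rewrite -H eqxx.
have := hq (ltn0Sn j); rewrite -(inj_eq invr_inj) invr1 -H.
by rewrite NegzE exprnN eqxx.
Qed.

(* A quotient in which two of the four entries vanish is a quantum plane. *)
Lemma prime_ring_qplane (T : algType k) (G : set T) (z w : T) :
  alg_gen G -> w * z = q *: (z * w) ->
  (forall g, G g -> [\/ g = 0, g = z | g = w]) ->
  (forall i j, z ^+ i * w ^+ j <> 0) -> prime_ring T.
Proof.
move=> genG wz Gzw zw0.
pose u (p : nat * nat) := z ^+ p.1 * w ^+ p.2.
(* Against [z] and [w], the monomial [z ^+ i * w ^+ j] has twists [q^-j] and [q^i], which determine
   the exponents. *)
apply: (@prime_ring_twisted _ T G _ u (fun p => (q ^+ p.2)^-1)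
  (fun p => q ^+ p.1) z w q
  [set v | exists (e : k) i j, e != 0 /\ v = e *: (z ^+ i * w ^+ j)]) => //.
- by exists (0, 0)%N; rewrite /u mulr1.
- move=> g [i j] /Gzw[->|->|->].
  + by exists 0, (0, 0)%N; rewrite mul0r scale0r.
  + by exists 1, (i.+1, j); rewrite scale1r /u exprS mulrA.
  by exists (q ^+ i), (i, j.+1);
    rewrite /u /= mulrA (qcommXr wz) -scalerAl -mulrA -exprS.
- move=> [i j]; rewrite /u /= -[_ * z]mulrA (qcommXl wz) -scalerAr scalerA.
  by rewrite mulVf ?expf_neq0 // scale1r !mulrA -exprS -exprSr.
- by move=> [i j];
    rewrite /u /= mulrA (qcommXr wz) -scalerAl -!mulrA -exprS -exprSr.
- move=> [i j] [i' j'] /= /invr_inj/expr_nonunity_inj -> /expr_nonunity_inj.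
  by move=> ->.
- move=> J [i j] n m iJ; rewrite /u /= -[_ * z ^+ n * _]mulrA.
  rewrite (qcomm_monoM _ _ _ _ wz).
  move=> Jx; eexists; last exact: Jx.
  by exists (q ^+ (j * n)), (i + n)%N, (j + m)%N; rewrite expf_neq0.
move=> v v' [e [i [j [e0 ->]]]] [e' [i' [j' [e'0 ->]]]].
rewrite -scalerAl -scalerAr scalerA (qcomm_monoM _ _ _ _ wz) scalerA.
move/eqP; rewrite scaler_eq0 !mulf_eq0 (negPf e0) (negPf e'0).
by rewrite (negPf (expf_neq0 _ hq0)) => /eqP/zw0.
Qed.

End RootOfUnity.

(** * The monomials that span R and their twists *)

Section Monomials.
Variables (k : fieldType) (q : k) (T : algType k) (a b c d : T).
Hypothesis hq0 : q != 0.
Hypothesis hq : forall n : nat, (0 < n)%N -> q ^+ n != 1.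
Hypothesis rels : qmx2_det0_rels q a b c d.

Let qV0 : q^-1 != 0. Proof. by rewrite invr_eq0. Qed.
Let ab : a * b = q *: (b * a). Proof. by case: rels. Qed.
Let ac : a * c = q *: (c * a). Proof. by case: rels. Qed.
Let db : d * b = q^-1 *: (b * d).
Proof. by apply: qcommV => //; case: rels. Qed.
Let dc : d * c = q^-1 *: (c * d).
Proof. by apply: qcommV => //; case: rels. Qed.
Let ca : c * a = q^-1 *: (a * c). Proof. exact: qcommV. Qed.
Let cd : c * d = q *: (d * c). Proof. by case: rels. Qed.
Let bc : b * c = c * b. Proof. by case: rels => _ _ _ _ []. Qed.
Let ad : a * d = q *: (b * c). Proof. by case: rels => _ _ _ _ []. Qed.
Let da : d * a = q^-1 *: (b * c). Proof. by case: rels => _ _ _ _ []. Qed.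
Let ad2 : a * d = (q ^+ 2) *: (d * a).
Proof. by rewrite ad da scalerA expr2 mulfK. Qed.

(** One integer exponent covers both kinds of powers, those of [d] counting as negative; [Negz n]
    stands for [-(n+1)]. *)
Definition adpow (m : int) : T :=
  match m with Posz n => a ^+ n | Negz n => d ^+ n.+1 end.

(** The scalar that [a] picks up in passing [adpow m]; the square comes from [ad = q^2 da]. *)
Definition ad_twist (m : int) : k :=
  match m with Posz n => 1 | Negz n => (q ^+ 2) ^+ n.+1 end.

Lemma ad_twist_neq0 m : ad_twist m != 0.
Proof. by case: m => n /=; rewrite ?oner_neq0 // !expf_neq0. Qed.

Lemma c_adpow m : c * adpow m = q ^ (- m) *: (adpow m * c).
Proof.
case: m => n /=; first by rewrite (qcommXr ca) exprVn exprnN.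
by rewrite (qcommXr cd) NegzE opprK.
Qed.

Lemma a_adpow m : a * adpow m = ad_twist m *: (adpow m * a).
Proof.
by case: m => n /=; [rewrite scale1r -exprS -exprSr|rewrite (qcommXr ad2)].
Qed.

Let bcX i j : b ^+ i * c ^+ j = c ^+ j * b ^+ i.
Proof. by apply: commrX; apply: commr_sym; apply: commrX; rewrite /GRing.comm bc. Qed.

Let cbX i : c * b ^+ i = b ^+ i * c.
Proof. by have := bcX i 1; rewrite expr1. Qed.

Let a_bc i j : a * (b ^+ i * c ^+ j) = q ^+ (i + j) *: (b ^+ i * c ^+ j * a).
Proof.
by rewrite (qcommM (qcommXr ab i) (qcommXr ac j)) exprD.
Qed.

Let d_bc i j : d * (b ^+ i * c ^+ j) = q^-1 ^+ (i + j) *: (b ^+ i * c ^+ j * d).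
Proof.
by rewrite (qcommM (qcommXr db i) (qcommXr dc j)) exprD.
Qed.

Let aM m : exists e s m', a * adpow m = e *: ((b * c) ^+ s * adpow m').
Proof.
case: m => [n|[|n]].
- by exists 1, 0%N, (Posz n.+1); rewrite scale1r mul1r /= exprS.
- by exists q, 1%N, (Posz 0); rewrite /= mulr1 !expr1 ad.
by exists q, 1%N, (Negz n); rewrite /= exprS mulrA ad -scalerAl expr1.
Qed.

Let dM m : exists e s m', d * adpow m = e *: ((b * c) ^+ s * adpow m').
Proof.
case: m => [[|n]|n].
- by exists 1, 0%N, (Negz 0); rewrite scale1r mul1r /= mulr1.
- by exists q^-1, 1%N, (Posz n); rewrite /= exprS mulrA da -scalerAl expr1.
by exists 1, 0%N, (Negz n.+1); rewrite scale1r mul1r /= [RHS]exprS.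
Qed.

Definition bcmono (p : nat * nat * int) : T := b ^+ p.1.1 * c ^+ p.1.2 * adpow p.2.

Let bcX2 s : (b * c) ^+ s = b ^+ s * c ^+ s.
Proof. by rewrite exprMn_comm // /GRing.comm. Qed.

Let bcXX i j s : b ^+ i * c ^+ j * (b * c) ^+ s = b ^+ (i + s) * c ^+ (j + s).
Proof.
by rewrite bcX2 mulrA -[b ^+ i * _ * _]mulrA -bcX mulrA -exprD -mulrA -exprD.
Qed.

Lemma bcmono_gen g p : [set a; b; c; d] g ->
  exists e p', g * bcmono p = e *: bcmono p'.
Proof.
case: p => [[i j] m]; rewrite /bcmono /=; case=> [[[->|->]|->]|->].
- have [e [s [m' E]]] := aM m; exists (q ^+ (i + j) * e), (i + s, j + s, m')%N.
  by rewrite mulrA a_bc -scalerAl -[_ * a * _]mulrA E -scalerAr scalerA mulrA bcXX.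
- by exists 1, (i.+1, j, m); rewrite scale1r /= exprS !mulrA.
- by exists 1, (i, j.+1, m); rewrite scale1r /= !mulrA cbX -[_ * c * _]mulrA -exprS.
have [e [s [m' E]]] := dM m; exists (q^-1 ^+ (i + j) * e), (i + s, j + s, m')%N.
by rewrite mulrA d_bc -scalerAl -[_ * d * _]mulrA E -scalerAr scalerA mulrA bcXX.
Qed.

Lemma bcmono1 : exists p, bcmono p = 1.
Proof. by exists (0, 0, Posz 0)%N; rewrite /bcmono /= !mulr1. Qed.

Lemma c_bcmono p : c * bcmono p = q ^ (- p.2) *: (bcmono p * c).
Proof.
case: p => [[i j] m]; rewrite /bcmono /= !mulrA.
have -> : c * b ^+ i * c ^+ j = b ^+ i * c ^+ j * c.
  by rewrite cbX -!mulrA -exprS -exprSr.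
by rewrite -mulrA c_adpow -scalerAr mulrA.
Qed.

Lemma a_bcmono p :
  a * bcmono p = (q ^+ (p.1.1 + p.1.2) * ad_twist p.2) *: (bcmono p * a).
Proof.
by case: p => [[i j] m]; rewrite (qcommM (a_bc i j) (a_adpow m)).
Qed.

(** The twist against [c] yields the integer exponent, and then the twist against [a] yields the
    total degree in [b] and [c]. The twists do not separate [b] from [c], which is why forms in [b],
    [c] appear instead of single monomials. *)
Lemma bcmono_twist_inj p p' : q ^ (- p.2) = q ^ (- p'.2) ->
  q ^+ (p.1.1 + p.1.2) * ad_twist p.2 = q ^+ (p'.1.1 + p'.1.2) * ad_twist p'.2 ->
  p.2 = p'.2 /\ (p.1.1 + p.1.2 = p'.1.1 + p'.1.2)%N.
Proof.
move/(exprz_nonunity_inj hq0 hq)/oppr_inj => ->.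
by move/(mulIf (ad_twist_neq0 _))/(expr_nonunity_inj hq0 hq).
Qed.

Let bc_a : a * (b * c) = q ^+ 2 *: (b * c * a).
Proof. by have := a_bc 1 1; rewrite !expr1. Qed.

Let bc_d : d * (b * c) = q^-1 ^+ 2 *: (b * c * d).
Proof. by have := d_bc 1 1; rewrite !expr1. Qed.

Let adX n : exists2 e, e != 0 & a ^+ n * d ^+ n = e *: (b * c) ^+ n.
Proof.
elim: n => [|n [e e0 IHn]]; first by exists 1; rewrite ?oner_neq0 // scale1r mulr1.
exists (e * (q ^+ 2) ^+ n * q); first by rewrite !mulf_neq0 ?expf_neq0.
have -> : a ^+ n.+1 * d ^+ n.+1 = a * (a ^+ n * d ^+ n) * d.
  by rewrite exprS exprSr !mulrA.
rewrite IHn -scalerAr -scalerAl (qcommXr bc_a) -scalerAl -[_ * a * d]mulrA ad.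
by rewrite -scalerAr -exprSr !scalerA.
Qed.

Let daX n : exists2 e, e != 0 & d ^+ n * a ^+ n = e *: (b * c) ^+ n.
Proof.
elim: n => [|n [e e0 IHn]]; first by exists 1; rewrite ?oner_neq0 // scale1r mulr1.
exists (e * (q^-1 ^+ 2) ^+ n * q^-1); first by rewrite !mulf_neq0 ?expf_neq0.
have -> : d ^+ n.+1 * a ^+ n.+1 = d * (d ^+ n * a ^+ n) * a.
  by rewrite exprS exprSr !mulrA.
rewrite IHn -scalerAr -scalerAl (qcommXr bc_d) -scalerAl -[_ * d * a]mulrA da.
by rewrite -scalerAr -exprSr !scalerA.
Qed.

Let adpowV m : exists m' s e, e != 0 /\ adpow m' * adpow m = e *: (b * c) ^+ s.
Proof.
case: m => [[|n]|n].
- by exists (Posz 0), 0%N, 1; rewrite oner_neq0 scale1r mulr1.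
- by have [e e0 E] := daX n.+1; exists (Negz n), n.+1, e.
by have [e e0 E] := adX n.+1; exists (Posz n.+1), n.+1, e.
Qed.

(* Multiplying by powers of a and d turns [adpow m] and [a ^+ j] into powers
   of bc. *)
Lemma ideal_absorb_adpow (J : set T) h m n j e1 e2 : is_ideal J ->
  e1 != 0 -> a * h = e1 *: (h * a) -> e2 != 0 -> d * h = e2 *: (h * d) ->
  J (h * adpow m * c ^+ n * a ^+ j) ->
  exists N, J (h * ((b * c) ^+ N * c ^+ n)).
Proof.
move=> iJ e10 ah e20 dh Jx.
(* [adpow m'] on the left and [d ^+ j] on the right complete [adpow m] and [a ^+ j] to powers of
   [bc]; moving [adpow m'] past [h] costs the scalar [e3]. *)
have [m' [s [e [e0 E]]]] := adpowV m; have [e' e'0 E'] := adX j.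
have [e3 e30 hE] : exists2 e3, e3 != 0 & adpow m' * h = e3 *: (h * adpow m').
  case: m' {E} => n' /=; first by exists (e1 ^+ n'); rewrite ?expf_neq0 ?(qcommXl ah).
  by exists (e2 ^+ n'.+1); rewrite ?expf_neq0 ?(qcommXl dh).
exists (s + j)%N; apply: (is_idealZV iJ (e := e3 * e * e')).
  by rewrite !mulf_neq0.
have := is_idealMr (d ^+ j) iJ (is_idealMl (adpow m') iJ Jx).
congr (J _); rewrite -!mulrA E' -!scalerAr [adpow m' * _]mulrA hE -!scalerAl.
rewrite -!mulrA [adpow m' * _]mulrA E -!scalerAl -!scalerAr !scalerA.
congr (_ *: _); first by rewrite -mulrA mulrC mulrA.
congr (_ * _); rewrite exprD -mulrA; congr (_ * _).
by apply/commrX/commr_sym/commrX; rewrite /GRing.comm bc -mulrA -bc.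
Qed.

End Monomials.

(** * Quotients in which b is a multiple of c *)

Section DiagonalQuotient.
Variables (k : fieldType) (q : k) (T : algType k) (a b c d : T) (la : k).
Hypothesis hq0 : q != 0.
Hypothesis hq : forall n : nat, (0 < n)%N -> q ^+ n != 1.
Hypothesis rels : qmx2_det0_rels q a b c d.
Hypothesis gen : alg_gen [set a; b; c; d].
Hypothesis la0 : la != 0.
Hypothesis bE : b = la *: c.

(** With [b = la c] the monomials reduce to [c^s] times a power of [a] or [d], and now the twists do
    separate them. Absorbing the power of [a] or [d] leaves a nonzero multiple of a power of [c]. *)
Lemma prime_ring_diag : (forall n, c ^+ n <> 0) -> prime_ring T.
Proof.
move=> cn0; have [_ ac _ _ _] := rels.
have monoE i j m : bcmono a b c d (i, j, m) =
    la ^+ i *: bcmono a b c d (0%N, (i + j)%N, m).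
  by rewrite /bcmono /= mul1r bE exprZn -!scalerAl exprD.
pose u (p : nat * int) := bcmono a b c d (0%N, p.1, p.2).
apply: (@prime_ring_twisted _ T _ _ u (fun p => q ^ (- p.2))
  (fun p => q ^+ p.1 * ad_twist q p.2) c a q
  [set v | exists2 e, e != 0 & exists n, v = e *: c ^+ n] gen) => //.
- by exists (0%N, Posz 0); rewrite /u /bcmono /= !mulr1.
- move=> g p Gg.
  have [e [[[i j] m]]] := bcmono_gen hq0 rels (0%N, p.1, p.2) Gg.
  rewrite monoE scalerA => E; exists (e * la ^+ i), (i + j, m)%N.
  by rewrite -E.
- by move=> p; have := c_bcmono hq0 rels (0%N, p.1, p.2).
- by move=> p; have := a_bcmono hq0 rels (0%N, p.1, p.2).
- move=> [s m] [s' m'] /= t1 t2.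
  have [/= -> ] := bcmono_twist_inj (p := (0%N, s, m)) (p' := (0%N, s', m'))
    hq0 hq t1 t2.
  by rewrite /= !add0n => ->.
- move=> J [s m] n j iJ; rewrite /u /bcmono /= mul1r => Jx.
  have ah : a * c ^+ s = q ^+ s *: (c ^+ s * a) by exact: qcommXr.
  have dh : d * c ^+ s = q^-1 ^+ s *: (c ^+ s * d).
    by apply: qcommXr; apply: qcommV => //; case: rels.
  have [||N] := ideal_absorb_adpow hq0 rels iJ _ ah _ dh Jx;
    rewrite ?expf_neq0 ?invr_eq0 //.
  rewrite bE -scalerAl exprZn -scalerAl -scalerAr -expr2 -exprM -!exprD => Jc.
  eexists; last exact: Jc.
  by exists (la ^+ N); rewrite ?expf_neq0 //; eexists.
move=> _ _ [e e0 [n ->]] [e' e'0 [n' ->]].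
rewrite -scalerAl -scalerAr scalerA -exprD => /eqP.
by rewrite scaler_eq0 mulf_eq0 (negPf e0) (negPf e'0) => /eqP/cn0.
Qed.

End DiagonalQuotient.

(** * Binary forms in b and c *)

Section HomogeneousForms.
Variables (k : fieldType) (T : algType k) (b c : T).
Hypothesis bc : b * c = c * b.

(** The homogenization [c^s f(b/c)] of degree [s]. Coefficients beyond degree [s] are cut off, hence
    the bounds on [size f] below. *)
Definition hform (s : nat) (f : {poly k}) : T :=
  \sum_(i < s.+1) f`_i *: (b ^+ i * c ^+ (s - i)).

Lemma hformD s f g : hform s (f + g) = hform s f + hform s g.
Proof.
by rewrite /hform -big_split; apply: eq_bigr => i _; rewrite coefD scalerDl.
Qed.

Lemma hformZ s e f : hform s (e *: f) = e *: hform s f.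
Proof.
by rewrite /hform scaler_sumr; apply: eq_bigr => i _; rewrite coefZ scalerA.
Qed.

Lemma hform0 s : hform s 0 = 0.
Proof. by rewrite -(scale0r 0) hformZ scale0r. Qed.

Lemma hformXn s i : (i <= s)%N -> hform s 'X^i = b ^+ i * c ^+ (s - i).
Proof.
move=> si; rewrite /hform (bigD1 (Ordinal (si : i < s.+1)%N)) //= coefXn eqxx.
rewrite scale1r big1 ?addr0 // => j; rewrite -val_eqE /= coefXn => /negPf ->.
by rewrite scale0r.
Qed.

Lemma hformMX s f : hform s.+1 ('X * f) = b * hform s f.
Proof.
rewrite /hform big_ord_recl coefXM /= scale0r add0r mulr_sumr.
apply: eq_bigr => i _; rewrite /bump leq0n add1n coefXM /= subSS -scalerAr.
by rewrite exprS mulrA.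
Qed.

Lemma hformS s (f : {poly k}) : (size f <= s.+1)%N ->
  hform s.+1 f = c * hform s f.
Proof.
move=> sf; rewrite /hform big_ord_recr /= (nth_default _ sf) scale0r addr0.
rewrite mulr_sumr; apply: eq_bigr => i _; rewrite -scalerAr mulrA.
have -> : c * b ^+ i = b ^+ i * c by apply: commrX; rewrite /GRing.comm bc.
by rewrite -mulrA -exprS subSn // -ltnS.
Qed.

Lemma hformC s e : hform s e%:P = e *: c ^+ s.
Proof.
by have := hformXn (leq0n s); rewrite -alg_polyC hformZ expr0 subn0 mul1r => ->.
Qed.

(** Homogenization turns the factor [X - t] into [b - t c]; iterated over roots, this factors a
    form. *)
Lemma hform_XsubC_mul s (f : {poly k}) t : (size f <= s.+1)%N ->
  hform s.+1 (('X - t%:P) * f) = (b - t *: c) * hform s f.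
Proof.
move=> sf; rewrite mulrBl mul_polyC hformD -scaleNr hformZ hformMX hformS //.
by rewrite scaleNr mulrBl scalerAl.
Qed.

Lemma hform_diag s (f : {poly k}) t : b = t *: c -> (size f <= s.+1)%N ->
  hform s f = f.[t] *: c ^+ s.
Proof.
move=> bt sf; rewrite /hform (horner_coef_wide _ sf) scaler_suml.
apply: eq_bigr => i _; rewrite bt exprZn -scalerAl scalerA -exprD subnKC //.
by rewrite -ltnS.
Qed.

Lemma hform_qcomm s f z e : z * b = e *: (b * z) -> z * c = e *: (c * z) ->
  z * hform s f = e ^+ s *: (hform s f * z).
Proof.
move=> zb zc; rewrite mulr_sumr mulr_suml scaler_sumr; apply: eq_bigr => i _.
have si : (i <= s)%N by rewrite -ltnS.
have := qcommM (qcommXr zb i) (qcommXr zc (s - i)).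
rewrite -exprD subnKC // -scalerAr => ->.
by rewrite -scalerAl !scalerA mulrC.
Qed.

End HomogeneousForms.

(** The form collects the terms of [x] that share the twists of one monomial [p0] with nonzero
    coefficient: they have the same power [adpow] and the same degree [s]. It is fixed before [J],
    so one form serves all ideals containing [x]. *)
Lemma ideal_hform (k : fieldType) (q : k) (T : algType k) (a b c d : T) x :
  q != 0 -> (forall n : nat, (0 < n)%N -> q ^+ n != 1) ->
  qmx2_det0_rels q a b c d -> alg_gen [set a; b; c; d] -> x <> 0 ->
  exists s (f : {poly k}), [/\ f != 0, (size f <= s.+1)%N
    & forall J : set T, is_ideal J -> J x ->
      exists N n, J (hform b c s f * ((b * c) ^+ N * c ^+ n))].
Proof.
move=> hq0 hq rels gen x0.
have [ab ac bd cd [bc _ _]] := rels.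
have Gu g p := @bcmono_gen k q T a b c d hq0 rels g p.
have [S [al [p0 [us xE sp0 al0]]]] :=
  alg_gen_span_neq0 gen (bcmono1 a b c d) Gu x0.
pose tau (p : nat * nat * int) := q ^ (- p.2).
pose sig (p : nat * nat * int) := q ^+ (p.1.1 + p.1.2) * ad_twist q p.2.
pose cond p := (tau p == tau p0) && (sig p == sig p0).
pose s := (p0.1.1 + p0.1.2)%N.
have condP p : cond p -> p.2 = p0.2 /\ (p.1.1 + p.1.2 = s)%N.
  by case/andP => /eqP t1 /eqP t2; apply: (bcmono_twist_inj hq0 hq t1 t2).
pose f : {poly k} := \sum_(p <- S | cond p) al p *: 'X^(p.1.1).
exists s, f; split.
(* The coefficient of degree [p0.1.1] is [al p0]: at fixed total degree the exponent of [b]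
   determines that of [c], so no other selected index contributes. *)
- apply/eqP => /(congr1 (fun g : {poly k} => g`_(p0.1.1))).
  rewrite coef0 coef_sum big_mkcond (bigD1_seq p0) //= {1}/cond !eqxx /=.
  rewrite coefZ coefXn eqxx mulr1 big1_seq ?addr0.
    by move/eqP; rewrite (negPf al0).
  move=> p /andP[pp0 _]; case: ifP => // /condP[p2 p1].
  rewrite coefZ coefXn; case: eqP => [E|_]; last by rewrite mulr0.
  have E2 : p.1.2 = p0.1.2 by apply: (@addnI p.1.1); rewrite p1 -E.
  case/eqP: pp0; rewrite [p]surjective_pairing [p0]surjective_pairing p2.
  by rewrite [p.1]surjective_pairing [p0.1]surjective_pairing -E E2.
- apply: (big_ind (fun g : {poly k} => (size g <= s.+1)%N)).
  + by rewrite size_poly0.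
  + by move=> g h sg sh; rewrite (leq_trans (size_polyD _ _)) // geq_max sg.
  move=> p /condP[_ ps]; rewrite (leq_trans (size_scale_leq _ _)) // size_polyXn.
  by rewrite -ps ltnS leq_addr.
move=> J iJ; rewrite xE => Jx.
have cx p : c * (al p *: bcmono a b c d p) = tau p *: (al p *: bcmono a b c d p * c).
  by rewrite -scalerAr (c_bcmono hq0 rels) -scalerAl !scalerA mulrC.
have ax p : a * (al p *: bcmono a b c d p) = sig p *: (al p *: bcmono a b c d p * a).
  by rewrite -scalerAr (a_bcmono hq0 rels) -scalerAl !scalerA mulrC.
have [n [m]] := twist_filter2 (tau p0) (sig p0) iJ hq0 ac cx ax Jx.
rewrite -2!mulr_suml.
have -> : \sum_(p <- S | cond p) al p *: bcmono a b c d p =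
    hform b c s f * adpow a d p0.2.
  rewrite /f (big_morph _ (hformD b c s) (hform0 b c s)) mulr_suml.
  apply: eq_bigr => p /condP[p2 ps]; rewrite hformZ -scalerAl; congr (_ *: _).
  by rewrite hformXn -?ps ?leq_addr // addKn /bcmono p2.
have ah : a * hform b c s f = q ^+ s *: (hform b c s f * a) by exact: hform_qcomm.
have dh : d * hform b c s f = q^-1 ^+ s *: (hform b c s f * d).
  by apply: hform_qcomm; apply: qcommV.
move=> Jh.
have [||N JN] := ideal_absorb_adpow hq0 rels iJ _ ah _ dh Jh;
  by rewrite ?expf_neq0 ?invr_eq0 //; exists N, n.
Qed.

(** * Primes of height 1 as minimal nonzero primes *)

(** An antichain of nonzero primes that has a member below every nonzero prime is the set of minimal
    nonzero primes; as 0 is prime, these are the primes of height 1. *)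
Lemma height1_primeP (R : nzRingType) (F : set R -> Prop) :
  is_prime_ideal [set 0 : R] ->
  (forall P, F P -> is_prime_ideal P) ->
  (forall P, F P -> ~ P `<=` [set 0]) ->
  (forall P P', F P -> F P' -> P `<=` P' -> P = P') ->
  (forall P, is_prime_ideal P -> ~ P `<=` [set 0] -> exists2 L, F L & L `<=` P) ->
  forall P : set R, height1_prime P <-> F P.
Proof.
move=> p0 Fp Fn0 Fanti Fsub P.
have zP (Q : set R) : is_prime_ideal Q -> [set 0] `<=` Q by case=> [[Q0 _ _] _ _] _ ->.
split=> [[pP [[C [Cp Clt C1]] Pmax]]|FP].
  have Pn0 : ~ P `<=` [set 0].
    move=> P0; have [_] := Clt 0%N isT; apply; rewrite C1.
    exact: classical_sets.subset_trans P0 (zP _ (Cp 0%N isT)).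
  have [L FL LP] := Fsub P pP Pn0.
  suff <- : L = P by [].
  apply: contrapT => LneP.
  (* A member [L] strictly below [P] gives the chain [0 < L < P] of length 2. *)
  suff : (2 <= 1)%N by [].
  apply: (Pmax 2%N (fun i =>
    if i is i'.+1 then if i' is _.+1 then P else L else [set 0])).
  split=> // [[|[|[|]]]|[|[|]]] // _.
  - exact: Fp.
  - by split; [apply: zP; apply: Fp|apply: Fn0].
  - by split=> // PL; apply: LneP; apply/seteqP.
have pP := Fp P FP; split=> //; split.
  exists (fun i => if i is _.+1 then P else [set 0]).
  by split=> // [[|[|]]|[|]] // _; split; [apply: zP|apply: Fn0].
move=> m C [Cp Clt Cm]; rewrite leqNgt; apply/negP => m1.
(* In a chain of length at least 2 the last member before [P] strictly contains another prime, so it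
   is nonzero and lies above some [L] of the antichain; then [L = P] contradicts strictness. *)
have Cn0 : ~ C m.-1 `<=` [set 0].
  move=> C0; have := Clt m.-2; rewrite prednK; last by case: m m1 {Cp Clt Cm C0} => [|[|]].
  case; first by case: m m1 {Cp Clt Cm C0} => [|[|]].
  move=> _; apply; apply: classical_sets.subset_trans C0 _; apply: zP; apply: Cp.
  by rewrite (leq_trans (leq_pred _)) ?leq_pred.
have [L FL LC] := Fsub _ (Cp _ (leq_pred m)) Cn0.
have := Clt m.-1; rewrite prednK ?(ltnW m1) // Cm => /(_ (leqnn _))[CP PC].
by apply: PC; rewrite -(Fanti L P FL FP (classical_sets.subset_trans LC CP)).
Qed.

(** Later arguments see the quotient only as a surjection with kernel [K], never through
    representatives. *)
Lemma quotient_exists (k : comNzRingType) (R : algType k) (K : set R) :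
  is_ideal K -> ~ K 1 -> exists (S : algType k) (f : {lrmorphism R -> S}),
    (forall u, exists x, f x = u) /\ (forall x, K x <-> f x = 0).
Proof.
move=> iK K1; pose I := ProperBideal iK K1.
exists (quot_alg I), (quot_pi I); split=> [u|x].
  by exists (quot_repr u); apply: quot_repK.
by rewrite -(rmorph0 (quot_pi I)); split=> [Kx|/quot_piP];
  [apply/quot_piP|]; rewrite subr0.
Qed.

Lemma alg_gen_morph (k : comNzRingType) (R S : algType k)
    (f : {lrmorphism R -> S}) (G : set R) :
  (forall u, exists x, f x = u) -> alg_gen G -> alg_gen (f @` G).
Proof.
move=> fS genG Q Q1 QD QZ QM u; have [x <-] := fS u; elim/genG: x.
- by rewrite rmorph1.
- by move=> x y Qx Qy; rewrite rmorphD; apply: QD.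
- by move=> e x Qx; rewrite linearZ; apply: QZ.
by move=> g x Gg Qx; rewrite rmorphM; apply: QM => //; exists g.
Qed.

(** * Matrix models for representations *)

Section ShiftMatrices.
Variables (k : fieldType) (n : nat).

Definition shift_mx : 'M[k]_n.+1 := \matrix_(i, j) (j == i.+1 :> nat)%:R.

Definition geom_mx (t : k) : 'M[k]_n.+1 := diag_mx (\row_i t ^+ i).

Lemma shift_geom_mx t : shift_mx * geom_mx t = t *: (geom_mx t * shift_mx).
Proof.
rewrite -!mulmxE /geom_mx mul_mx_diag mul_diag_mx; apply/matrixP => i j.
rewrite !mxE; case: eqP => [->|_]; last by rewrite mul0r !mulr0.
by rewrite mul1r mulr1 exprS.
Qed.

Lemma geom_mxM s t : geom_mx s * geom_mx t = geom_mx (s * t).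
Proof.
rewrite -mulmxE /geom_mx mul_diag_mx; apply/matrixP => i j; rewrite !mxE.
by case: eqP => [->|_]; rewrite ?mulr1n ?mulr0n ?mulr0 ?exprMn.
Qed.

Lemma geom_mx1 : geom_mx 1 = 1.
Proof.
by apply/matrixP => i j; rewrite !mxE expr1n.
Qed.

Lemma geom_mxX t i : geom_mx t ^+ i = geom_mx (t ^+ i).
Proof. by elim: i => [|i IHi]; rewrite ?geom_mx1 // exprS IHi geom_mxM -exprS. Qed.

(** The diagonal factor is invertible, and the [n]-th power of the shift of size [n+1] has entry 1
    in its upper right corner. *)
Lemma geom_shift_mx_neq0 t i : t != 0 -> geom_mx t ^+ i * shift_mx ^+ n <> 0.
Proof.
move=> t0 E; have : shift_mx ^+ n = 0.
  rewrite -[LHS]mul1r -geom_mx1 -(@mulVf _ (t ^+ i)) ?expf_neq0 //.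
  by rewrite -geom_mxM -geom_mxX -mulrA E mulr0.
have shiftX m : (m <= n)%N -> forall j : 'I_n.+1,
    (shift_mx ^+ m) 0 j = (j == m :> nat)%:R.
  elim: m => [_ j|m IHm mn j]; first by rewrite expr0 mxE eq_sym.
  rewrite exprSr -mulmxE mxE.
  rewrite (bigD1 (Ordinal (ltnW mn : (m < n.+1)%N))) //= IHm ?(ltnW mn) //.
  rewrite eqxx mul1r mxE /=.
  rewrite big1 ?addr0 // => l; rewrite -val_eqE /= => /negPf lm.
  by rewrite IHm ?(ltnW mn) // lm mul0r.
move=> /matrixP/(_ 0 ord_max); rewrite shiftX // mxE eqxx => /eqP.
by rewrite oner_eq0.
Qed.

End ShiftMatrices.

(** Two matrix units from the first row, off the diagonal: a model for two generators that stay
    independent modulo the square of the augmentation ideal. *)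
Lemma square_zero_plane (k : fieldType) : exists (T : algType k) (u v : T),
  [/\ u * u = 0, u * v = 0, v * u = 0, v * v = 0
    & forall x y : k, x *: u + y *: v = 0 -> x = 0 /\ y = 0].
Proof.
pose o1 : 'I_3 := Ordinal (isT : (1 < 3)%N).
pose o2 : 'I_3 := Ordinal (isT : (2 < 3)%N).
exists 'M[k]_3, (delta_mx 0 o1), (delta_mx 0 o2).
split; try by rewrite -mulmxE mul_delta_mx_0.
move=> x y /matrixP E; have := E 0 o1; have := E 0 o2; rewrite !mxE /=.
by rewrite !mulr1 !mulr0 addr0 add0r => -> ->.
Qed.

(** * Prime ideals of an algebra with the presentation of R *)

Section MainTheory.
Variables (k : closedFieldType) (q : k).
Hypothesis hq0 : q != 0.
Hypothesis hq : forall n : nat, (0 < n)%N -> q ^+ n != 1.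
Variables (R : algType k) (a b c d : R).
Hypothesis rels : qmx2_det0_rels q a b c d.
Hypothesis gen : alg_gen [set a; b; c; d].
Hypothesis lift : forall (T : algType k) (A B C D : T),
  qmx2_det0_rels q A B C D ->
  exists f : {lrmorphism R -> T}, [/\ f a = A, f b = B, f c = C & f d = D].

Let qV0 : q^-1 != 0. Proof. by rewrite invr_eq0. Qed.

Lemma ideal_gen_ker (T : algType k) (f : {lrmorphism R -> T}) (S : set R) :
  (forall x, S x -> f x = 0) -> forall x, ideal_gen S x -> f x = 0.
Proof. by move=> fS x; apply: (ideal_gen_sub (ker_is_ideal f) fS). Qed.

(** A representation sends [c] to the nilpotent shift [Y] of size [n+1], [b] to [la *: Y] and [a] to
    a diagonal matrix: [b - la c] vanishes there, [c^n] does not. *)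
Lemma diag_notin la n : ~ ideal_gen [set b - la *: c] (c ^+ n).
Proof.
pose Y : 'M[k]_n.+1 := shift_mx k n.
pose X : 'M[k]_n.+1 := geom_mx n q; pose X' : 'M[k]_n.+1 := geom_mx n q^-1.
have YX : Y * X = q *: (X * Y) by exact: shift_geom_mx.
have YX' : Y * X' = q^-1 *: (X' * Y) by exact: shift_geom_mx.
have XX' : X * X' = 1 by rewrite geom_mxM mulfV // geom_mx1.
have X'X : X' * X = 1 by rewrite geom_mxM mulVf // geom_mx1.
have X'Y : X' * Y = q *: (Y * X') by rewrite (qcommV qV0 YX') invrK.
have Y2X' : Y ^+ 2 * X' = q^-1 ^+ 2 *: (X' * Y ^+ 2) by exact: qcommXl.
have YXY : Y * (X * Y ^+ 2) = q *: (X * Y ^+ 2 * Y).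
  by rewrite mulrA YX -scalerAl -!mulrA; congr (_ *: (_ * _)); rewrite -exprS exprSr.
(* The image of [d] is forced by [ad = q bc], because [X'] has the inverse [X]. *)
have [|f [_ fb fc _]] := @lift _ X' (la *: Y) Y ((q * la) *: (X * Y ^+ 2)).
  split.
  - by rewrite -scalerAr X'Y -scalerAl !scalerA mulrC.
  - exact: X'Y.
  - by rewrite -!scalerAl -!scalerAr YXY !scalerA; congr (_ *: _);
      rewrite mulrC [la * _]mulrC mulrA.
  - by rewrite -!scalerAr -!scalerAl YXY !scalerA; congr (_ *: _); rewrite mulrC.
  split.
  - by rewrite -scalerAl -scalerAr.
  - by rewrite -scalerAr mulrA X'X mul1r -scalerAl scalerA expr2.
  rewrite -scalerAl -mulrA Y2X' -scalerAr mulrA XX' mul1r -scalerAl !scalerA -expr2.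
  by congr (_ *: _); rewrite mulrAC expr2 mulrA mulfV // mul1r.
move=> /(ideal_gen_ker (f := f)) H.
have : f (c ^+ n) = 0.
  by apply: H => _ ->; rewrite lrmorphBZ fb fc subrr.
have -> : f (c ^+ n) = f c ^+ n by exact: rmorphXn.
rewrite fc => Yn0.
by apply: (@geom_shift_mx_neq0 k n q 0 hq0); rewrite expr0 mul1r.
Qed.

(* The pairs x, y for which R / <x, y> is a quantum plane on z and w. *)
Definition corner (x y z w : R) : Prop :=
  [\/ [/\ x = a, y = b, z = d & w = c], [/\ x = b, y = d, z = c & w = a],
      [/\ x = a, y = c, z = d & w = b] | [/\ x = c, y = d, z = b & w = a]].

Lemma corner_qcomm x y z w : corner x y z w -> w * z = q *: (z * w).
Proof. by case: rels => ab ac bd cd _; case=> -[_ _ -> ->]. Qed.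

Lemma corner_gen x y z w g : corner x y z w -> [set a; b; c; d] g ->
  [\/ g = x, g = y, g = z | g = w].
Proof.
by case=> -[-> -> -> ->] [[[->|->]|->]|->];
  (constructor 1; reflexivity) || (constructor 2; reflexivity)
  || (constructor 3; reflexivity) || (constructor 4; reflexivity).
Qed.

(** Except in [wz = q zw], every product in the relations has a factor [x] or [y], so all other
    relations hold when [X] and [Y] annihilate all four images. *)
Lemma corner_lift x y z w (T : algType k) (X Y Z W : T) : corner x y z w ->
  X * X = 0 -> X * Y = 0 -> Y * X = 0 -> Y * Y = 0 ->
  X * Z = 0 -> X * W = 0 -> Z * X = 0 -> W * X = 0 ->
  Y * Z = 0 -> Y * W = 0 -> Z * Y = 0 -> W * Y = 0 ->
  W * Z = q *: (Z * W) ->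
  exists f : {lrmorphism R -> T}, [/\ f x = X, f y = Y, f z = Z & f w = W].
Proof.
move=> cxy XX XY YX YY XZ XW ZX WX YZ YW ZY WY WZ.
case: cxy => -[-> -> -> ->].
- have [|f [? ? ? ?]] := @lift T X Y W Z; last by exists f.
  split=> //; last split;
    by rewrite ?(XX, XY, YX, YY, XZ, XW, ZX, WX, YZ, YW, ZY, WY) ?scaler0.
- have [|f [? ? ? ?]] := @lift T W X Z Y; last by exists f.
  split=> //; last split;
    by rewrite ?(XX, XY, YX, YY, XZ, XW, ZX, WX, YZ, YW, ZY, WY) ?scaler0.
- have [|f [? ? ? ?]] := @lift T X W Y Z; last by exists f.
  split=> //; last split;
    by rewrite ?(XX, XY, YX, YY, XZ, XW, ZX, WX, YZ, YW, ZY, WY) ?scaler0.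
have [|f [? ? ? ?]] := @lift T W Z X Y; last by exists f.
split=> //; last split;
  by rewrite ?(XX, XY, YX, YY, XZ, XW, ZX, WX, YZ, YW, ZY, WY) ?scaler0.
Qed.

(** With [x] and [y] sent to 0, the quantum plane acts by a geometric diagonal matrix and a shift
    whose [j]-th power is nonzero. *)
Lemma corner_notin x y z w i j : corner x y z w ->
  ~ ideal_gen [set x; y] (z ^+ i * w ^+ j).
Proof.
move=> cxy; pose Y : 'M[k]_j.+1 := shift_mx k j.
pose X : 'M[k]_j.+1 := geom_mx j q.
have [|||||||||||||f [fx fy fz fw]] :=
  corner_lift (X := 0) (Y := 0) (Z := X) (W := Y) cxy;
  rewrite ?mulr0 ?mul0r //; first exact: shift_geom_mx.
move=> /(ideal_gen_ker (f := f)) H.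
apply: (@geom_shift_mx_neq0 k j q i hq0).
have <- : f (z ^+ i * w ^+ j) = 0 by apply: H => _ [->|->].
by rewrite rmorphM !rmorphXn /= fz fw.
Qed.

(** Sending [x], [y] to independent square-zero elements [u], [v] and [z], [w] to 0 maps the ideal
    onto a plane, whereas an ideal with one generator [p] maps into the line through [f p]. *)
Lemma corner_not_normal x y z w : corner x y z w ->
  ~ normally_generated (ideal_gen [set x; y]).
Proof.
move=> cxy [p [_ Ep]].
have [T [u [v [uu uv vu vv uvI]]]] := square_zero_plane k.
have [|||||||||||||f [fx fy fz fw]] :=
  corner_lift (X := u) (Y := v) (Z := 0) (W := 0) cxy;
  rewrite ?mulr0 ?mul0r ?scaler0 //.
have fE r : exists e e1 e2, f r = e%:A + (e1 *: u + e2 *: v).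
  elim/gen: r => [|r r' [e [e1 [e2 E]]] [e' [e1' [e2' E']]]
    |t r [e [e1 [e2 E]]]|g r Gg [e [e1 [e2 E]]]].
  - by exists 1, 0, 0; rewrite rmorph1 !scale0r scale1r !addr0.
  - exists (e + e'), (e1 + e1'), (e2 + e2').
    by rewrite rmorphD /= E E' !scalerDl addrACA; congr (_ + _); rewrite addrACA.
  - exists (t * e), (t * e1), (t * e2).
    by rewrite linearZ /= E !scalerDr !scalerA.
  rewrite rmorphM /= E.
  case: (corner_gen cxy Gg) => ->; rewrite ?fx ?fy ?fz ?fw.
  - exists 0, e, 0; rewrite !mulrDr -!scalerAr uu uv mulr1 !scaler0 !scale0r.
    by rewrite !addr0 add0r.
  - exists 0, 0, e; rewrite !mulrDr -!scalerAr vu vv mulr1 !scaler0 !scale0r.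
    by rewrite !addr0 !add0r.
  - by exists 0, 0, 0; rewrite mul0r !scale0r !addr0.
  - by exists 0, 0, 0; rewrite mul0r !scale0r !addr0.
(* On the plane of [u] and [v], an element of the image acts from either side by its constant
   term. *)
have lin2 (e e' e1 e2 e1' e2' : k) :
    (e%:A + (e1 *: u + e2 *: v)) * (e' *: (e1' *: u + e2' *: v)) =
      (e * e') *: (e1' *: u + e2' *: v)
    /\ (e' *: (e1' *: u + e2' *: v)) * (e%:A + (e1 *: u + e2 *: v)) =
      (e' * e) *: (e1' *: u + e2' *: v).
  have z0 (x1 x2 y1 y2 : k) : (x1 *: u + x2 *: v) * (y1 *: u + y2 *: v) = 0.
    rewrite mulrDl !mulrDr -!scalerAl -!scalerAr uu uv vu vv !scaler0.
    by rewrite !addr0.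
  rewrite mulrDl mulrDr -!scalerAr -!scalerAl !z0 !scaler0 !addr0.
  by rewrite mulr1 mul1r !scalerA [e' * e]mulrC.
have [e1 [e2 fp]] : exists e1 e2, f p = e1 *: u + e2 *: v.
  have : ideal_gen [set x; y] p by rewrite Ep; apply: sub_ideal_gen.
  apply: (@ideal_gen_sub _ _ [set r | exists e1 e2, f r = e1 *: u + e2 *: v]).
    split=> /= [|r r' [e1 [e2 E]] [e1' [e2' E']]|r' r [e1 [e2 E]]].
    - by exists 0, 0; rewrite rmorph0 !scale0r addr0.
    - exists (e1 - e1'), (e2 - e2'); rewrite rmorphB /= E E' !scalerBl.
      by rewrite opprD addrACA.
    have [e' [e1' [e2' E']]] := fE r'.
    have [L1 L2] := lin2 e' 1 e1' e2' e1 e2.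
    rewrite !scale1r mulr1 mul1r in L1 L2.
    by split; exists (e' * e1), (e' * e2);
      rewrite rmorphM /= E E' ?L1 ?L2 scalerDr !scalerA.
  by move=> _ [->|->] /=; [exists 1, 0|exists 0, 1];
    rewrite ?fx ?fy scale1r scale0r ?addr0 ?add0r.
have fI r : ideal_gen [set x; y] r -> exists e, f r = e *: (e1 *: u + e2 *: v).
  rewrite Ep.
  apply: (@ideal_gen_sub _ _ [set r | exists e, f r = e *: (e1 *: u + e2 *: v)]).
    split=> /= [|s s' [e E] [e' E']|s' s [e E]].
    - by exists 0; rewrite rmorph0 scale0r.
    - by exists (e - e'); rewrite rmorphB /= E E' scalerBl.
    have [e' [e1' [e2' E']]] := fE s'.
    have [L1 L2] := lin2 e' e e1' e2' e1 e2.
    by split; eexists; rewrite rmorphM /= E E' ?L1 ?L2.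
  by move=> _ -> /=; exists 1; rewrite scale1r.
have [t E1] : exists e, f x = e *: (e1 *: u + e2 *: v).
  by apply: fI; apply: sub_ideal_gen; left.
have [t' E2] : exists e, f y = e *: (e1 *: u + e2 *: v).
  by apply: fI; apply: sub_ideal_gen; right.
(* Both [u] and [v] are multiples of [e1 u + e2 v]. Coordinates of [u] give [t e1 = 1] and
   [t e2 = 0], so [e2 = 0], against [t' e2 = 1]. *)
have [|/eqP A1 A2] := uvI (t * e1 - 1) (t * e2).
  rewrite scalerBl scale1r addrAC; apply/eqP; rewrite subr_eq0.
  by rewrite -!scalerA -scalerDr -E1 fx.
have [|/eqP B1 /eqP B2] := uvI (t' * e1) (t' * e2 - 1).
  rewrite scalerBl scale1r addrA; apply/eqP; rewrite subr_eq0.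
  by rewrite -!scalerA -scalerDr -E2 fy.
have t0 : t != 0 by apply: contraTneq A1 => ->; rewrite mul0r sub0r oppr_eq0 oner_eq0.
move/eqP: A2; rewrite mulf_eq0 (negPf t0) /= => /eqP e20.
by move: B2; rewrite e20 mulr0 sub0r oppr_eq0 oner_eq0.
Qed.

(** * Primeness of the listed ideals and of zero *)

Lemma alg_gen_morph4 (S : algType k) (f : {lrmorphism R -> S}) :
  (forall u, exists x, f x = u) -> alg_gen [set f a; f b; f c; f d].
Proof.
by move=> fS; have := alg_gen_morph fS gen; rewrite !image_setU !image_set1.
Qed.

Lemma diag_in la : ideal_gen [set b - la *: c] (b - la *: c).
Proof. exact: sub_ideal_gen. Qed.

Lemma diag_proper la : ~ ideal_gen [set b - la *: c] 1.
Proof. by have := diag_notin (la := la) (n := 0); rewrite expr0. Qed.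

Lemma diag_prime la : la != 0 -> is_prime_ideal (ideal_gen [set b - la *: c]).
Proof.
move=> la0; have iK := ideal_gen_is_ideal [set b - la *: c].
have [S [f [fS fK]]] := quotient_exists iK (diag_proper (la := la)).
apply: (prime_ring_quotient (f := f)) => //; [exact: rmorphM|exact: diag_proper|].
apply: (prime_ring_diag hq0 hq (qmx2_det0_rels_morph f rels)
  (alg_gen_morph4 fS) la0).
  by apply/eqP; rewrite -subr_eq0 -lrmorphBZ; apply/eqP/fK; exact: diag_in.
move=> n; have <- : f (c ^+ n) = f c ^+ n by exact: rmorphXn.
by move/fK; apply: diag_notin.
Qed.

Lemma corner_prime x y z w : corner x y z w ->
  is_prime_ideal (ideal_gen [set x; y]).
Proof.
move=> cxy; have iK := ideal_gen_is_ideal [set x; y].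
have K1 : ~ ideal_gen [set x; y] 1.
  by have := corner_notin (i := 0) (j := 0) cxy; rewrite !expr0 mulr1.
have [S [f [fS fK]]] := quotient_exists iK K1.
apply: (prime_ring_quotient (f := f)) => //; first exact: rmorphM.
apply: (prime_ring_qplane hq0 hq (z := f z) (w := f w) (alg_gen_morph fS gen)).
- by apply: lrmorph_rel; rewrite (corner_qcomm cxy) subrr rmorph0.
- have fx0 : f x = 0 by apply/fK; apply: sub_ideal_gen; left.
  have fy0 : f y = 0 by apply/fK; apply: sub_ideal_gen; right.
  move=> _ [g Gg <-]; case: (corner_gen cxy Gg) => ->.
  + by rewrite fx0; constructor 1.
  + by rewrite fy0; constructor 1.
  + by constructor 2.
  by constructor 3.
move=> i j; have <- : f (z ^+ i * w ^+ j) = f z ^+ i * f w ^+ j.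
  by rewrite rmorphM !rmorphXn.
by move/fK; apply: corner_notin.
Qed.

(** Modulo [b - la c] the element becomes [f(la) la^N c^(s+2N+n)], and no power of [c] vanishes
    there. *)
Lemma hform_diag_notin la s (f : {poly k}) N n :
  la != 0 -> (size f <= s.+1)%N -> f.[la] != 0 ->
  ~ ideal_gen [set b - la *: c] (hform b c s f * ((b * c) ^+ N * c ^+ n)).
Proof.
move=> la0 sf fla; have iK := ideal_gen_is_ideal [set b - la *: c].
have [S [g [gS gK]]] := quotient_exists iK (diag_proper (la := la)).
have gb : g b = la *: g c.
  by apply/eqP; rewrite -subr_eq0 -lrmorphBZ; apply/eqP/gK; exact: diag_in.
have gh : g (hform b c s f) = hform (g b) (g c) s f.
  rewrite /hform rmorph_sum; apply: eq_bigr => i _.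
  by rewrite [LHS]linearZ /= rmorphM !rmorphXn.
have gM : g (hform b c s f * ((b * c) ^+ N * c ^+ n)) =
   (f.[la] * la ^+ N) *: g (c ^+ (s + (2 * N + n))).
  have gbc : g (b * c) = la *: g c ^+ 2 by rewrite rmorphM /= gb -scalerAl.
  have gX r m : g (r ^+ m) = g r ^+ m by exact: rmorphXn.
  rewrite rmorphM rmorphM /= gh (hform_diag gb sf) !gX gbc exprZn -exprM.
  by rewrite -!(scalerAl, scalerAr) scalerA -!exprD.
move/gK; rewrite gM => /eqP; rewrite scaler_eq0 mulf_eq0 (negPf fla).
by rewrite (negPf (expf_neq0 _ la0)) => /eqP/gK/diag_notin.
Qed.

(** Nonzero [x] in [I] and [y] in [J] have forms given by [f] and [g]. For [la] outside their roots,
    the prime of [b - la c] contains [IJ = 0], hence [I] or [J], hence a multiple of a form that it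
    cannot contain. *)
Lemma zero_prime : is_prime_ideal [set 0 : R].
Proof.
split.
- split=> // [x y -> ->|r x ->]; first by rewrite subrr.
  by rewrite mulr0 mul0r.
- by move=> /seteqP[_ /(_ 1 Logic.I) /= /eqP]; rewrite oner_eq0.
move=> I J iI iJ IJ.
apply: contrapT => /not_orP[/existsNP[x /not_implyP[Ix x0]]].
move=> /existsNP[y /not_implyP[Jy y0]].
have [s [f [f0 sf fJ]]] := ideal_hform hq0 hq rels gen x0.
have [s' [g [g0 sg gJ]]] := ideal_hform hq0 hq rels gen y0.
(* The factor ['X] makes [la] nonzero. *)
have /closed_nonrootP[la] : 'X * f * g != 0 by rewrite !mulf_neq0 ?polyX_eq0.
rewrite !rootE !hornerM hornerX !mulf_eq0 !negb_or => /andP[/andP[la0 fla] gla].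
have iK := ideal_gen_is_ideal [set b - la *: c].
have [_ _ PP] := diag_prime la0.
have [|IK|JK] := PP I J iI iJ.
- by move=> t /IJ ->; apply: is_ideal0.
- have [N [n]] := fJ _ iK (IK x Ix); exact: hform_diag_notin.
have [N [n]] := gJ _ iK (JK y Jy); exact: hform_diag_notin.
Qed.

(** * Normal elements inside prime ideals *)

Lemma normal_mod (J : set R) u : is_ideal J ->
  (forall g, [set a; b; c; d] g -> exists e, J (u * g - e *: (g * u))) ->
  forall r, exists r', J (u * r - r' * u).
Proof.
move=> iJ uG; elim/gen => [|r s [r' Jr] [s' Js]|e r [r' Jr]|g r Gg [r' Jr]].
- by exists 1; rewrite mulr1 mul1r subrr; apply: is_ideal0.
- by exists (r' + s'); rewrite mulrDr mulrDl opprD addrACA; apply: is_idealD.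
- exists (e *: r'); rewrite -scalerAr -scalerAl -scalerBr; exact: is_idealZ.
have [e Je] := uG g Gg; exists (e *: (g * r')).
rewrite (_ : _ - _ = (u * g - e *: (g * u)) * r + (e *: g) * (u * r - r' * u)).
  by apply: is_idealD => //; [apply: is_idealMr|apply: is_idealMl].
by rewrite mulrBl mulrBr -!scalerAl !mulrA addrA subrK.
Qed.

(** [b] and [c] have the same twist against each generator, so their combinations have it too. Two
    coefficients let one statement cover [b], [c] and [b - t c]. *)
Lemma normal_bc s t g : [set a; b; c; d] g ->
  exists2 e, e != 0 & (s *: b - t *: c) * g = e *: (g * (s *: b - t *: c)).
Proof.
case: rels => ab ac bd cd [bc _ _].
have mulE h e : b * h = e *: (h * b) -> c * h = e *: (h * c) ->
    (s *: b - t *: c) * h = e *: (h * (s *: b - t *: c)).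
  move=> bg cg; rewrite mulrBl mulrBr -!scalerAl -!scalerAr bg cg scalerBr.
  by rewrite !scalerA ![_ * e]mulrC.
case=> [[[->|->]|->]|->].
- by exists q^-1 => //; apply: mulE; exact: qcommV.
- by exists 1; [exact: oner_neq0|apply: mulE; rewrite scale1r].
- by exists 1; [exact: oner_neq0|apply: mulE; rewrite scale1r].
by exists q => //; apply: mulE.
Qed.

(** Modulo [P], the product [u r v] equals [r' u v], so all of [uRv] lies in [P]. *)
Lemma prime_normal (P : set R) u v : is_prime_ideal P ->
  (forall r, exists r', P (u * r - r' * u)) -> P (u * v) -> P u \/ P v.
Proof.
move=> pP uN Puv; have [iP _ _] := pP; apply: prime_ideal_elem => // r.
have [r' Pr] := uN r; rewrite -[u * r](subrK (r' * u)) mulrDl -mulrA.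
by apply: is_idealD => //; [apply: is_idealMr|apply: is_idealMl].
Qed.

Lemma prime_normal_bc (P : set R) s t v : is_prime_ideal P ->
  P ((s *: b - t *: c) * v) -> P (s *: b - t *: c) \/ P v.
Proof.
move=> pP; have [iP _ _] := pP; apply: prime_normal => //; apply: normal_mod => //.
move=> g /(normal_bc s t)[e _ E]; exists e; rewrite E subrr; exact: is_ideal0.
Qed.

Lemma prime_bX (P : set R) n v : is_prime_ideal P ->
  P (b ^+ n * v) -> P b \/ P v.
Proof.
move=> pP; elim: n => [|n IHn]; first by rewrite mul1r; right.
rewrite exprS -mulrA; have := @prime_normal_bc P 1 0 (b ^+ n * v) pP.
by rewrite scale1r scale0r subr0 => H /H[|/IHn]; [left|].
Qed.

Lemma prime_cX (P : set R) n v : is_prime_ideal P ->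
  P (c ^+ n * v) -> P c \/ P v.
Proof.
move=> pP; elim: n => [|n IHn]; first by rewrite mul1r; right.
rewrite exprS -mulrA; have := @prime_normal_bc P 0 (-1) (c ^+ n * v) pP.
by rewrite scale0r sub0r scaleN1r opprK => H /H[|/IHn]; [left|].
Qed.

(** Induction on the degree: a root [la] of [f] splits off the normal factor [b - la c], which is
    [b] itself if [la = 0]. A constant [f] leaves only powers of [b] and [c]. *)
Lemma prime_hform (P : set R) s (f : {poly k}) N n : is_prime_ideal P ->
  f != 0 -> (size f <= s.+1)%N ->
  P (hform b c s f * ((b * c) ^+ N * c ^+ n)) ->
  [\/ P b, P c | exists2 la, la != 0 & P (b - la *: c)].
Proof.
move=> pP; have [iP PT _] := pP; have [_ _ _ _ [bc _ _]] := rels.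
have constP m (g : {poly k}) : g != 0 -> (size g <= 1)%N ->
    P (hform b c m g * ((b * c) ^+ N * c ^+ n)) -> P b \/ P c.
  move=> g0 /size1_polyC gE; rewrite gE hformC -scalerAl.
  move=> /(is_idealZV iP) Pc.
  have {Pc}/(prime_cX pP)[Pc|] : P (c ^+ m * ((b * c) ^+ N * c ^+ n)).
    by apply: Pc; apply: contraNneq g0 => E; rewrite gE E.
  - by right.
  rewrite exprMn_comm // -mulrA => /(prime_bX pP)[Pb|]; first by left.
  move/(prime_cX pP) => [Pc|]; first by right.
  rewrite -[c ^+ n]mulr1 => /(prime_cX pP)[Pc|P1]; first by right.
  case: PT; apply/seteqP; split=> // r _.
  by rewrite -[r]mulr1; apply: is_idealMl.
elim: s f => [|s IHs] f f0 sf Pf.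
  by have [Pb|Pc] := constP _ _ f0 sf Pf; [constructor 1|constructor 2].
case: (leqP (size f) 1) => [f1|f1].
  by have [Pb|Pc] := constP _ _ f0 f1 Pf; [constructor 1|constructor 2].
have /closed_rootP[la /factor_theorem[g fE]] : size f != 1 by rewrite gtn_eqF.
have g0 : g != 0 by apply: contraNneq f0 => g0; rewrite fE g0 mul0r.
have sg : (size g <= s.+1)%N.
  by move: sf; rewrite fE size_Mmonic ?monicXsubC // size_XsubC addn2.
move: Pf; rewrite fE mulrC hform_XsubC_mul // -mulrA.
have := @prime_normal_bc P 1 la (hform b c s g * ((b * c) ^+ N * c ^+ n)) pP.
rewrite scale1r => H /H[Pb|]; last exact: IHs.
have [la0|la0] := eqVneq la 0; last by constructor 3; exists la.
by constructor 1; move: Pb; rewrite la0 scale0r subr0.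
Qed.

(** As [ad] lies in [P], the element [a] is normal modulo [P], with scalar 0 against [d]; then [ad]
    in [P] splits. *)
Lemma prime_bc (P : set R) : is_prime_ideal P -> P (b * c) -> P a \/ P d.
Proof.
move=> pP Pbc; have [iP _ _] := pP; have [ab ac bd cd [bc ad da]] := rels.
apply: (prime_normal pP); last by rewrite ad; apply: is_idealZ.
apply: normal_mod => // g [[[->|->]|->]|->].
- by exists 1; rewrite scale1r subrr; apply: is_ideal0.
- by exists q; rewrite ab subrr; apply: is_ideal0.
- by exists q; rewrite ac subrr; apply: is_ideal0.
by exists 0; rewrite scale0r subr0 ad; apply: is_idealZ.
Qed.

(** * The list of minimal nonzero primes *)

Definition minimal_list (P : set R) : Prop :=
  (exists2 la, la != 0 & P = ideal_gen [set b - la *: c]) \/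
  [\/ P = ideal_gen [set a; b], P = ideal_gen [set b; d],
      P = ideal_gen [set a; c] | P = ideal_gen [set c; d]].

Lemma minimal_list_prime P : minimal_list P -> is_prime_ideal P.
Proof.
case=> [[la la0 ->]|]; first exact: diag_prime.
case=> ->.
- by apply: (@corner_prime a b d c); constructor 1.
- by apply: (@corner_prime b d c a); constructor 2.
- by apply: (@corner_prime a c d b); constructor 3.
by apply: (@corner_prime c d b a); constructor 4.
Qed.

Lemma minimal_list_below P : is_prime_ideal P -> ~ P `<=` [set 0] ->
  exists2 L, minimal_list L & L `<=` P.
Proof.
move=> pP /existsNP[x /not_implyP[Px x0]]; have [iP _ _] := pP.
have [s [f [f0 sf /(_ P iP Px)[N [n]]]]] := ideal_hform hq0 hq rels gen x0.
have gen2 u v : P u -> P v -> ideal_gen [set u; v] `<=` P.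
  by move=> Pu Pv; apply: ideal_gen_sub => // _ [->|->].
case/(prime_hform pP f0 sf) => [Pb|Pc|[la la0 Pla]].
- have [Pa|Pd] := prime_bc pP (is_idealMr c iP Pb).
    by exists (ideal_gen [set a; b]); [right; constructor 1|apply: gen2].
  by exists (ideal_gen [set b; d]); [right; constructor 2|apply: gen2].
- have [Pa|Pd] := prime_bc pP (is_idealMl b iP Pc).
    by exists (ideal_gen [set a; c]); [right; constructor 3|apply: gen2].
  by exists (ideal_gen [set c; d]); [right; constructor 4|apply: gen2].
exists (ideal_gen [set b - la *: c]); first by left; exists la.
by apply: ideal_gen_sub => // _ ->.
Qed.

Lemma diag_bc_notin la : la != 0 ->
  ~ ideal_gen [set b - la *: c] b /\ ~ ideal_gen [set b - la *: c] c.
Proof.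
move=> la0; have iK := ideal_gen_is_ideal [set b - la *: c].
have cK : ~ ideal_gen [set b - la *: c] c.
  by have := @diag_notin la 1; rewrite expr1.
split=> // bK; apply: cK; apply: (is_idealZV iK la0).
by have := is_idealB iK bK (@diag_in la); rewrite subKr.
Qed.

Lemma corner_mem x y z w : corner x y z w ->
  [/\ ideal_gen [set x; y] x, ideal_gen [set x; y] y,
      ~ ideal_gen [set x; y] z & ~ ideal_gen [set x; y] w].
Proof.
move=> cxy; split.
- by apply: sub_ideal_gen; left.
- by apply: sub_ideal_gen; right.
- by have := corner_notin (i := 1) (j := 0) cxy; rewrite expr0 mulr1.
by have := corner_notin (i := 0) (j := 1) cxy; rewrite expr0 mul1r.
Qed.

Let cab : corner a b d c. Proof. by constructor 1. Qed.
Let cbd : corner b d c a. Proof. by constructor 2. Qed.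
Let cac : corner a c d b. Proof. by constructor 3. Qed.
Let ccd : corner c d b a. Proof. by constructor 4. Qed.

(** The difference of the two generators is [(mu - la) c], and [c] lies outside the ideal of
    [b - mu c]. *)
Lemma diag_inj la mu : mu != 0 ->
  ideal_gen [set b - la *: c] `<=` ideal_gen [set b - mu *: c] -> la = mu.
Proof.
move=> mu0 /(_ _ (@diag_in la)) laK; apply/eqP; rewrite eq_sym -subr_eq0.
have [//|E] := eqVneq; have [_] := diag_bc_notin mu0; case.
have iK := ideal_gen_is_ideal [set b - mu *: c].
apply: (is_idealZV iK E).
have <- : b - la *: c - (b - mu *: c) = (mu - la) *: c.
  by rewrite scalerBl opprB addrC addrA subrK.
exact: is_idealB iK laK (@diag_in mu).
Qed.

(** Membership of [a], [b], [c], [d] decides: each of the four ideals contains exactly one of [b],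
    [c]; an ideal containing [b - la c] contains both or neither; the ideal of [b - mu c] contains
    neither. *)
Lemma minimal_list_incomparable P P' :
  minimal_list P -> minimal_list P' -> P `<=` P' -> P = P'.
Proof.
have [aab bab dab cab'] := corner_mem cab; have [bbd dbd cbd' abd] := corner_mem cbd.
have [aac cac' dac bac] := corner_mem cac; have [ccd' dcd bcd acd] := corner_mem ccd.
have diag_sub la S : la != 0 -> ideal_gen [set b - la *: c] `<=` ideal_gen S ->
    (ideal_gen S b -> ideal_gen S c) /\ (ideal_gen S c -> ideal_gen S b).
  move=> la0 /(_ _ (@diag_in la)) H; have iS := ideal_gen_is_ideal S; split=> [Sb|Sc].
    by apply: (is_idealZV iS la0); have := is_idealB iS Sb H; rewrite subKr.
  by have := is_idealD iS H (is_idealZ la iS Sc); rewrite subrK.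
case=> [[la la0 ->]|LP] [[mu mu0 ->]|LP'].
- by move=> /(diag_inj mu0) ->.
- by case: LP' => -> /(diag_sub _ _ la0)[]; tauto.
- have [bmu cmu] := diag_bc_notin mu0.
  by case: LP => -> s; move: (s b) (s c); tauto.
by case: LP => ->; case: LP' => -> // s; exfalso;
  move: (s a) (s b) (s c) (s d); tauto.
Qed.

(** A zero ideal in the list would lie in, hence equal, both [<b, d>] and [<a, c>], but only the
    latter contains [c]. *)
Lemma minimal_list_neq0 P : minimal_list P -> ~ P `<=` [set 0].
Proof.
move=> LP P0.
have P0' (P' : set R) : is_ideal P' -> P `<=` P'.
  by move=> iP' x /P0 ->; apply: is_ideal0.
have E x y z w : corner x y z w -> minimal_list (ideal_gen [set x; y]) ->
    P = ideal_gen [set x; y].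
  move=> cxy L; apply: minimal_list_incomparable => //.
  by apply: P0'; apply: ideal_gen_is_ideal.
have [_ _ nc _] := corner_mem cbd; apply: nc.
rewrite -(E _ _ _ _ cbd) ?(E _ _ _ _ cac); last by right; constructor 2.
  by apply: sub_ideal_gen; right.
by right; constructor 3.
Qed.

Lemma height1_minimal_list (P : set R) : height1_prime P <-> minimal_list P.
Proof.
apply: height1_primeP.
- exact: zero_prime.
- exact: minimal_list_prime.
- exact: minimal_list_neq0.
- exact: minimal_list_incomparable.
exact: minimal_list_below.
Qed.

(** * Normal generators and the count of exceptions *)

(** The scalars by which [b - la c] passes the generators are invertible, so induction gives both
    [uR] inside [Ru] and the converse. *)
Lemma diag_normally_generated la : normally_generated (ideal_gen [set b - la *: c]).
Proof.
exists (b - la *: c); split=> //.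
have uG g : [set a; b; c; d] g -> exists2 e, e != 0 &
    (b - la *: c) * g = e *: (g * (b - la *: c)).
  by move=> /(normal_bc 1 la); rewrite scale1r.
set u := b - la *: c in uG *; apply/seteqP; split=> _ [r _ <-].
  elim/gen: r => [|r s [r' _ Er] [s' _ Es]|e r [r' _ Er]|g r Gg [r' _ Er]].
  - by exists 1; rewrite ?mulr1 ?mul1r.
  - by exists (r' + s') => //; rewrite mulrDl Er Es mulrDr.
  - by exists (e *: r') => //; rewrite -scalerAl Er scalerAr.
  have [e e0 E] := uG g Gg; exists (e *: (g * r')) => //.
  by rewrite mulrA E -!scalerAl -!mulrA Er.
elim/gen: r => [|r s [r' _ Er] [s' _ Es]|e r [r' _ Er]|g r Gg [r' _ Er]].
- by exists 1; rewrite ?mulr1 ?mul1r.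
- by exists (r' + s') => //; rewrite mulrDr Er Es mulrDl.
- by exists (e *: r') => //; rewrite -scalerAr Er scalerAl.
have [e e0 E] := uG g Gg; exists (e^-1 *: (g * r')) => //.
by rewrite -scalerAr mulrA E -scalerAl scalerA mulVf // scale1r -mulrA Er mulrA.
Qed.

(** The parameters [q^n] are nonzero and pairwise distinct. *)
Lemma height1_infinite : infinite_set [set P : set R | height1_prime P].
Proof.
pose F n := ideal_gen [set b - q ^+ n *: c].
have qn0 n : q ^+ n != 0 by exact: expf_neq0.
move=> fin; apply: infinite_nat.
have -> : [set: nat] = F @^-1` [set P : set R | height1_prime P].
  apply/seteqP; split=> // n _; apply/height1_minimal_list.
  by left; exists (q ^+ n).
apply: finite_preimage fin => m n _ _ FE; apply: (expr_nonunity_inj hq0 hq).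
by apply: diag_inj => //; rewrite -/(F m) FE.
Qed.

Lemma height1_not_normal_card :
  ([set P : set R | height1_prime P /\ ~ normally_generated P] #= `I_4)%card.
Proof.
have [aab bab dab cab'] := corner_mem cab; have [bbd dbd cbd' abd] := corner_mem cbd.
have [aac cac' dac bac] := corner_mem cac; have [ccd' dcd bcd acd] := corner_mem ccd.
pose F n := match n with 0%N => ideal_gen [set a; b] | 1%N => ideal_gen [set b; d]
  | 2%N => ideal_gen [set a; c] | _ => ideal_gen [set c; d] end.
suff -> : [set P : set R | height1_prime P /\ ~ normally_generated P] = F @` `I_4.
  (* Equal values of [F] would contain the same elements among [a], [b], [c], [d]. *)
  apply: inj_card_eq => m n; rewrite !inE /=.
  case: m n => [|[|[|[|m]]]] [|[|[|[|n]]]] //= _ _ E; exfalso;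
    have [] := (conj (congr1 (fun A : set R => A a) E)
      (congr1 (fun A : set R => A b) E));
    have [] := (conj (congr1 (fun A : set R => A c) E)
      (congr1 (fun A : set R => A d) E));
    move=> E1 E2 E3 E4; rewrite ?E1 ?E2 ?E3 ?E4 in aab bab dab cab' bbd dbd
      cbd' abd aac cac' dac bac ccd' dcd bcd acd; tauto.
apply/seteqP; split=> [P [/height1_minimal_list LP nP]|_ [n n4 <-]].
  case: LP => [[la _ PE]|]; first by case: nP; rewrite PE; apply: diag_normally_generated.
  by case=> ->; [exists 0%N|exists 1%N|exists 2%N|exists 3%N].
case: n n4 => [|[|[|[|]]]] //= _; split.
- by apply/height1_minimal_list; right; constructor 1.
- exact: corner_not_normal cab.
- by apply/height1_minimal_list; right; constructor 2.
- exact: corner_not_normal cbd.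
- by apply/height1_minimal_list; right; constructor 3.
- exact: corner_not_normal cac.
- by apply/height1_minimal_list; right; constructor 4.
exact: corner_not_normal ccd.
Qed.

End MainTheory.

(** * Transfer to ideals of the quantum matrix algebra modulo its determinant *)

(** Images of ideals under the surjection and preimages of ideals are ideals; this gives the two
    inclusions. *)
Lemma ideal_mod_det_gen (k : fieldType) (q : k) (S : set (qmx2 q)) :
  ideal_mod_det (ideal_gen S) = ideal_gen (quot_pi (qdet_ideal q) @` S).
Proof.
pose f : {lrmorphism qmx2 q -> qmx2_mod_det q} := quot_pi (qdet_ideal q).
have iS := ideal_gen_is_ideal S.
apply/seteqP; split=> [_ [x Sx <-]|]; last first.
  apply: ideal_gen_sub; first exact: quot_pi_ideal.
  by move=> _ [x Sx <-]; exists x => //; apply: sub_ideal_gen.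
have [J0 JB JM] := ideal_gen_is_ideal (f @` S).
suff : [set x | ideal_gen (f @` S) (f x)] x by [].
move: x Sx; apply: ideal_gen_sub; last first.
  by move=> x Sx /=; apply: sub_ideal_gen; exists x.
split=> /= [|x y Jx Jy|r x Jx]; first by rewrite rmorph0.
  by rewrite rmorphB; apply: JB.
by rewrite !rmorphM; apply: JM.
Qed.

Theorem mainTheorem8 (k : closedFieldType) (q : k) (hq0 : q != 0)
    (hq : forall n : nat, (0 < n)%N -> q ^+ n != 1) :
  let a := qmx2_a q in
  let b := qmx2_b q in
  let c := qmx2_c q in
  let d := qmx2_d q in
  let Delta := qdet q in
  let R := qmx2_mod_det q in
  let I (lambda : k) : set R :=
    ideal_mod_det (ideal_gen [set Delta; b - lambda *: c]) in
  let Iab : set R := ideal_mod_det (ideal_gen [set a; b]) in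
  let Ibd : set R := ideal_mod_det (ideal_gen [set b; d]) in
  let Iac : set R := ideal_mod_det (ideal_gen [set a; c]) in
  let Icd : set R := ideal_mod_det (ideal_gen [set c; d]) in
  [/\ forall P : set R, height1_prime P <->
        (exists2 lambda : k, lambda != 0 & P = I lambda) \/
        [\/ P = Iab, P = Ibd, P = Iac | P = Icd],
      forall lambda : k, lambda != 0 -> normally_generated (I lambda),
      [/\ ~ normally_generated Iab, ~ normally_generated Ibd,
          ~ normally_generated Iac & ~ normally_generated Icd]
    & infinite_set [set P : set R | height1_prime P] /\
      ([set P : set R | height1_prime P /\ ~ normally_generated P] #= `I_4)%card].
Proof.
move=> a b c d Delta R I Iab Ibd Iac Icd.
pose f : {lrmorphism qmx2 q -> R} := quot_pi (qdet_ideal q).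
have rels := qmx2_mod_det_rels q.
have gen := @qmx2_mod_det_gen k q.
have lift := @qmx2_mod_det_lift k q.
have pairE x y : ideal_mod_det (ideal_gen [set x; y]) = ideal_gen [set f x; f y].
  by rewrite ideal_mod_det_gen image_setU !image_set1.
(* [Delta] maps to 0 in R, so one generator is left. *)
have IE la : I la = ideal_gen [set f b - la *: f c].
  rewrite /I pairE -(lrmorphBZ f); have -> : f Delta = 0.
    by rewrite (lrmorphMZ f); case: rels => _ _ _ _ [_ -> _]; rewrite subrr.
  have iJ := ideal_gen_is_ideal [set f (b - la *: c)].
  apply/seteqP; split; apply: ideal_gen_sub => //.
  - by move=> _ [->|->]; [apply: is_ideal0|apply: sub_ideal_gen].
  - exact: ideal_gen_is_ideal.
  by move=> _ ->; apply: sub_ideal_gen; right.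
rewrite /Iab /Ibd /Iac /Icd !pairE; split.
- move=> P; rewrite (height1_minimal_list hq0 hq rels gen lift P).
  split=> -[[la la0 ->]|H]; try by right.
    by left; exists la.
  by left; exists la.
- by move=> la la0; rewrite IE; apply: (diag_normally_generated hq0 rels gen).
- split.
  + by apply: (corner_not_normal gen lift); constructor 1.
  + by apply: (corner_not_normal gen lift); constructor 2.
  + by apply: (corner_not_normal gen lift); constructor 3.
  by apply: (corner_not_normal gen lift); constructor 4.
split; first exact: (height1_infinite hq0 hq rels gen lift).
exact: (height1_not_normal_card hq0 hq rels gen lift).
Qed.
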